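(* Let $\bm P$ be a Beta Markov stick-breaking process with parameters $(N,\bm\alpha,\bm\beta,P_0)$ and weights $\bm w$. Then: (i) if $\sum_{j\ge1}\alpha_j/(\alpha_j+\beta_j)=\infty$ and $\limsup_{j\to\infty}(\alpha_j+\beta_j)^{-1}<\infty$, then $\bm P$ is proper; (ii) for every $j\ge1$, $w_j>0$ a.s.; (iii) $\bm P$ has full support.
   Context: Let $N\in\{0,1,\dots\}$ and $\bm\alpha=(\alpha_j)$, $\bm\beta=(\beta_j)$ sequences of positive numbers; $F_j(v)=\mathcal I_v(\alpha_j,\beta_j)$ (the $\mathrm{Beta}(\alpha_j,\beta_j)$ distribution function) and $\Upsilon_j=F_{j+1}^{-1}\circ F_j$. A Beta Markov stick-breaking process (BMSBp) with parameters $(N,\bm\alpha,\bm\beta,P_0)$ is $\bm P=\sum_jw_j\delta_{\theta_j}+(1-\sum_jw_j)P_0$ where $w_1=v_1$, $w_j=v_j\prod_{i<j}(1-v_i)$, $\bm v$ is a Markov chain with $v_1\sim\mathrm{Beta}(\alpha_1,\beta_1)$ and transitions $\mathbb P[v_{j+1}\in du\mid v_j=v]=\sum_{z=0}^N\mathrm{Beta}(du\mid\alpha_{j+1}+z,\beta_{j+1}+N-z)\binom Nz\Upsilon_j(v)^z(1-\Upsilon_j(v))^{N-z}$, $P_0$ is a diffuse probability measure on a complete separable metric space $\mathbb X$, and $\theta_j$ are iid $P_0$ independent of $\bm w$. Proper means $\sum_jw_j=1$ a.s.; full support means every probability measure on $\mathbb X$ with support contained in that of $P_0$ lies in the weak-topology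 support of the law of $\bm P$. *)

(* Defs.v *)
From HB Require Import structures.
From mathcomp Require Import all_boot all_order all_algebra.
From mathcomp Require Import all_classical all_reals all_analysis.
Set Implicit Arguments. Unset Strict Implicit. Unset Printing Implicit Defensive.
Import Order.TTheory GRing.Theory Num.Theory.
Import numFieldNormedType.Exports.
Local Open Scope classical_set_scope.
Local Open Scope ring_scope.

Section BMSBp.
Context {R : realType}.

Definition beta_dens (a b : R) (x : R) : R :=
  if (0 < x) && (x < 1) then x `^ (a - 1) * (1 - x) `^ (b - 1) else 0.

Definition betaB (a b : R) : R :=
  fine (\int[lebesgue_measure]_(x in `[0%R, 1%R]) (beta_dens a b x)%:E)%E.

Definition betaL (a b : R) (B : set R) : \bar R :=
  ((\int[lebesgue_measure]_(x in B) (beta_dens a b x)%:E) * (betaB a b)^-1%:E)%E.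

Definition betaF (a b : R) (v : R) : R := fine (betaL a b `]-oo, v]).

Definition betaFinv (a b : R) (u : R) : R :=
  inf [set v : R | 0 <= v <= 1 /\ u <= betaF a b v].

(** Upsilon_j = F_{j+1}^{-1} o F_j  (sequences indexed from 0: index j here
    is j+1 in the paper). *)
Definition Ups (al be : nat -> R) (j : nat) (v : R) : R :=
  betaFinv (al j.+1) (be j.+1) (betaF (al j) (be j) v).

Definition bmsb_kernel (N : nat) (al be : nat -> R) (j : nat) (v : R)
    (B : set R) : \bar R :=
  (\sum_(z < N.+1)
     (('C(N, z))%:R * Ups al be j v ^+ z * (1 - Ups al be j v) ^+ (N - z))%:E
     * betaL (al j.+1 + z%:R) (be j.+1 + (N - z)%:R) B)%E.

Definition stick_w {Omega : Type} (v : nat -> Omega -> R) (j : nat)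
    (w : Omega) : R :=
  v j w * \prod_(i < j) (1 - v i w).

Definition bmsb_measure {dX} {X : measurableType dX} {Omega : Type}
    (P0 : probability X R) (v : nat -> Omega -> R) (th : nat -> Omega -> X)
    (w : Omega) (A : set X) : R :=
  limn (fun n => \sum_(j < n) (stick_w v j w * \1_A (th j w)))
  + (1 - limn (fun n => \sum_(j < n) stick_w v j w)) * fine (P0 A).

Definition bmsb_integral {dX} {X : measurableType dX} {Omega : Type}
    (P0 : probability X R) (v : nat -> Omega -> R) (th : nat -> Omega -> X)
    (f : X -> R) (w : Omega) : R :=
  limn (fun n => \sum_(j < n) (stick_w v j w * f (th j w)))
  + (1 - limn (fun n => \sum_(j < n) stick_w v j w)) * fine (\int[P0]_x (f x)%:E)%E.

Definition is_BMSBp {dX} {X : measurableType dX} {d} {Omega : measurableType d}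
    (N : nat) (al be : nat -> R) (P0 : probability X R)
    (Pr : probability Omega R)
    (v : nat -> Omega -> R) (th : nat -> Omega -> X) : Prop :=
  [/\ (forall j, measurable_fun setT (v j)),
      (forall j, measurable_fun setT (th j)),
      (forall B, measurable B -> Pr (v 0%N @^-1` B) = betaL (al 0%N) (be 0%N) B),
      (forall (j : nat) (A : nat -> set R) (B : set R),
          (forall i, measurable (A i)) -> measurable B ->
          Pr ([set w | forall i, (i <= j)%N -> A i (v i w)] `&` (v j.+1 @^-1` B))
          = (\int[Pr]_(w in [set w | forall i, (i <= j)%N -> A i (v i w)])
               bmsb_kernel N al be j (v j w) B)%E) &
      (forall (n : nat) (A : nat -> set R) (C : nat -> set X),
          (forall i, measurable (A i)) -> (forall i, measurable (C i)) ->
          Pr [set w | forall i, (i < n)%N -> A i (v i w) /\ C i (th i w)]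
          = (Pr [set w | forall i, (i < n)%N -> A i (v i w)]
             * \prod_(i < n) P0 (C i))%E)].

Definition bmsb_proper {d} {Omega : measurableType d} (Pr : probability Omega R)
    (v : nat -> Omega -> R) : Prop :=
  {ae Pr, forall w, (fun n => \sum_(j < n) stick_w v j w) @ \oo --> (1 : R)}.

Definition diffuse {dX} {X : measurableType dX} (P0 : probability X R) : Prop :=
  forall x : X, P0 [set x] = 0%E.

End BMSBp.

Definition separable_space (T : topologicalType) : Prop :=
  exists D : set T, countable D /\ closure D = setT.

Notation borel T := (g_sigma_algebraType (@open T)).

Definition msupport {R : realType} {T : ptopologicalType}
    (mu : set (borel T) -> \bar R) : set T :=
  [set x | forall U : set T, open U -> U x -> (0 < mu U)%E].

(** Full support of the law of the random measure in the weak topology: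
    every Q with supp Q in supp P0 lies in the support of the law of P,
    i.e. every basic weak neighbourhood
    {P : |int f_i dP - int f_i dQ| < eps, i < k} (f_i bounded continuous)
    has positive probability. *)
Definition full_support {R : realType} {T : ptopologicalType}
    {d} {Omega : measurableType d} (Pr : probability Omega R)
    (P0 : probability (borel T) R)
    (v : nat -> Omega -> R) (th : nat -> Omega -> borel T) : Prop :=
  forall Q : probability (borel T) R, msupport Q `<=` msupport P0 ->
  forall (k : nat) (f : 'I_k -> T -> R) (eps : R), 0 < eps ->
    (forall i, continuous (f i)) ->
    (forall i, exists M : R, forall x, `|f i x| <= M) ->
    exists A : set Omega, [/\ measurable A, (0 < Pr A)%E &
      forall w, A w -> forall i,
        `| bmsb_integral P0 v th (f i) w - fine (\int[Q]_x (f i x)%:E)%E | < eps].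

(* Main.v *)
(** Let [R_n] be the mass left after the first [n] sticks, i.e. the product of
    the [1 - v_i].

    (i) Since [Upsilon] lies in [0, 1], the conditional mean of [v_{j+1}] given [v_j] is at
    least [al_{j+1} / (al_{j+1} + be_{j+1} + N)].  As [1 / (al + be)] is bounded, these lower
    bounds have a divergent sum; conditioning successively, [E R_n] tends to 0, and so does the
    nonincreasing sequence [R_n] almost surely.

    (ii) Every transition probability is absolutely continuous on the open unit interval.

    (iii) Approximate [Q], on the given test functions, by a finite combination of Dirac masses
    at points [x_l] of its support, with weights [q_l].  Every interval has a transition
    probability bounded below uniformly in the current state, so with positive probability the
    first sticks realise weights close to the [q_l], the corresponding atoms fall in small
    neighbourhoods of the [x_l] (which are charged by [P0]), and the remaining mass is
    negligible, whatever it is spread on. *)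

Require Import Defs.
From HB Require Import structures.
From mathcomp Require Import all_boot all_order all_algebra.
From mathcomp Require Import all_classical all_reals all_analysis.
From mathcomp Require Import measurable_realfun ring lra.
Set Implicit Arguments.
Unset Strict Implicit.
Unset Printing Implicit Defensive.
Import Order.TTheory GRing.Theory Num.Theory.
Import numFieldNormedType.Exports.
Local Open Scope classical_set_scope.
Local Open Scope ring_scope.

(** * Beta integrals *)

Section Integrals01.
Context {R : realType}.
Notation mu := (@lebesgue_measure R).

(** The segment stays away from 0 and 1, where a beta density may blow up, so hypotheses on the open
    unit interval suffice. *)
Lemma FTC2_oo01 (F f : R -> R) :
  (forall x : R, 0 < x < 1 -> is_derive x 1 F (f x)) ->
  (forall x : R, 0 < x < 1 -> {for x, continuous f}) ->
  forall a b, 0 < a -> a < b -> b < 1 ->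
  (\int[mu]_(x in `[a, b]) (f x)%:E = (F b - F a)%:E)%E.
Proof.
move=> dF cf a b a0 ab b1.
have cF x : 0 < x < 1 -> {for x, continuous F}.
  move=> /dF h; apply: differentiable_continuous.
  by apply/derivable1_diffP; apply: ex_derive.
rewrite (@continuous_FTC2 _ f F)//.
- apply: continuous_in_subspaceT => x; rewrite inE/= in_itv/= => /andP[ax xb].
  by apply: cf; rewrite (lt_le_trans a0 ax) (le_lt_trans xb b1).
- split.
  + move=> x; rewrite in_itv/= => /andP[ax xb].
    have h := dF x; apply: ex_derive; apply: h.
    by rewrite (lt_trans a0 ax) (lt_trans xb b1).
  + apply: cvg_at_right_filter; apply: cF.
    by rewrite a0 (lt_trans ab b1).
  + apply: cvg_at_left_filter; apply: cF.
    by rewrite b1 (lt_trans a0 ab).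
- move=> x; rewrite in_itv/= => /andP[ax xb].
  rewrite derive1E; have h := dF x; apply: derive_val; apply: h.
  by rewrite (lt_trans a0 ax) (lt_trans xb b1).
Qed.

(** Compact exhaustion of the open unit interval. The shift by 3 makes every member nondegenerate,
    also for [n = 0]. *)
Definition itv01 (n : nat) : set R := `[n.+3%:R^-1, 1 - n.+3%:R^-1].

Lemma itv01_bounds (n : nat) :
  [/\ 0 < n.+3%:R^-1 :> R, n.+3%:R^-1 < 1 - n.+3%:R^-1 :> R
    & 1 - n.+3%:R^-1 < 1 :> R].
Proof.
have h0 : 0 < n.+3%:R^-1 :> R by rewrite invr_gt0.
split; [exact: h0| |by rewrite gtrBl].
rewrite ltrBrDl -mulr2n -(mulr_natl n.+3%:R^-1) ltr_pdivrMr// mul1r ltr_nat.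
by [].
Qed.

Lemma bigcup_itv01 : \bigcup_n itv01 n = `]0, 1[%classic.
Proof.
apply/seteqP; split => [x [n _]|x]; rewrite /itv01/= !in_itv/=.
  have [h0 _ h1] := itv01_bounds n.
  by move=> /andP[h2 h3]; rewrite (lt_le_trans h0 h2) (le_lt_trans h3 h1).
move=> /andP[x0 x1].
pose m := Num.min x (1 - x).
have m0 : 0 < m by rewrite lt_min x0 subr_gt0.
exists (Num.truncn m^-1) => //; rewrite /itv01/=.
have h : (Num.truncn m^-1).+3%:R^-1 <= m.
  rewrite -[leRHS]invrK lef_pV2 ?posrE ?invr_gt0//.
  apply: ltW; apply: (lt_le_trans (truncnS_gt _)).
  by rewrite ler_nat ltnS; do 2 apply: leqW.
rewrite in_itv/= (le_trans h) ?ge_min ?lexx//=.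
by rewrite lerBrDl -lerBrDr (le_trans h) ?ge_min ?lexx ?orbT.
Qed.

Lemma nd_itv01 : nondecreasing_seq itv01.
Proof.
apply/nondecreasing_seqP => n; apply/subsetPset => x; rewrite /itv01/= !in_itv/=.
have h : n.+4%:R^-1 <= n.+3%:R^-1 :> R by rewrite lef_pV2 ?posrE// ler_nat.
move=> /andP[h1 h2]; rewrite (le_trans h h1)/= (le_trans h2)//.
by rewrite lerD2l lerN2.
Qed.

Lemma cvg_integral_itv01 (f : R -> R) : measurable_fun setT f ->
  (forall x, 0 <= f x) ->
  (\int[mu]_(x in itv01 n) (f x)%:E @[n --> \oo] -->
   \int[mu]_(x in `]0%R, 1%R[) (f x)%:E)%E.
Proof.
move=> mf f0; rewrite -bigcup_itv01.
apply: ge0_nondecreasing_set_cvg_integral.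
- exact: nd_itv01.
- by move=> i; exact: measurable_itv.
- by move=> i; apply/measurable_EFinP; exact: measurable_funS mf.
- by move=> i x _; rewrite lee_fin.
Qed.

(** Over each compact subinterval the integral is a difference of two values of [F], hence at most
    [M + M]; monotone convergence carries the bound over to the whole interval. *)
Lemma FTC2_01_le (F f : R -> R) (M : R) : measurable_fun setT f ->
  (forall x, 0 <= f x) ->
  (forall x : R, 0 < x < 1 -> is_derive x 1 F (f x)) ->
  (forall x : R, 0 < x < 1 -> {for x, continuous f}) ->
  (forall x : R, 0 < x < 1 -> `|F x| <= M) ->
  (\int[mu]_(x in `]0%R, 1%R[) (f x)%:E <= (M + M)%:E)%E.
Proof.
move=> mf f0 dF cf bF.
apply: (cvge_to_le (cvg_integral_itv01 mf f0)).
near=> n.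
have [h0 h1 h2] := itv01_bounds n.
rewrite (FTC2_oo01 dF cf)// lee_fin (le_trans (ler_norm _))//.
rewrite (le_trans (ler_normB _ _))// lerD//; apply: bF.
  by rewrite h2 (lt_trans h0 h1).
by rewrite h0 (lt_trans h1 h2).
Unshelve. all: end_near. Qed.

End Integrals01.

(** * The beta density: integrability, positivity, integration by parts *)

Section BetaDensity.
Context {R : realType}.
Notation mu := (@lebesgue_measure R).
Implicit Types a b p q x : R.

Lemma powR_le1 p x : 0 <= p -> 0 <= x <= 1 -> x `^ p <= 1.
Proof.
move=> p0 /andP[x0 x1]; rewrite -[leRHS](congr1 (@^~ p) (powR1 R)).
by rewrite ge0_ler_powR// nnegrE.
Qed.

(** The formula of the beta density without its cutoff; on the open unit interval the derivatives
    are combinations of members of the same family. *)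
Definition powR_onem p q x : R := x `^ p * (1 - x) `^ q.

Lemma powR_onem_ge0 p q x : 0 <= powR_onem p q x.
Proof. by rewrite mulr_ge0 ?powR_ge0. Qed.

Lemma measurable_powR_onem p q : measurable_fun setT (powR_onem p q).
Proof.
apply: measurable_funM; first exact: measurable_powR.
apply: (@measurableT_comp _ _ _ _ _ _ (@powR R ^~ q)).
  exact: measurable_powR.
exact: measurable_funB.
Qed.

Lemma is_derive1_powR_onem p q x : 0 < x < 1 ->
  is_derive x 1 (powR_onem p q)
    (p * powR_onem (p - 1) q x - q * powR_onem p (q - 1) x).
Proof.
move=> /andP[x0 x1].
have y0 : 0 < 1 - x by rewrite subr_gt0.
have h1 : is_derive x 1 (fun y : R => 1 - y) (-1).
  have := is_deriveB (is_derive_cst (1 : R) x 1) (is_derive_id x 1).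
  rewrite sub0r; exact.
have h2 : is_derive (1 - x) 1 (@powR R ^~ q) (q * (1 - x) `^ (q - 1)).
  exact: is_derive1_powR.
have h3 := @is_derive1_comp _ (@powR R ^~ q) (fun y : R => 1 - y) x _ _ h2 h1.
have h4 : is_derive x 1 (@powR R ^~ p) (p * x `^ (p - 1)).
  exact: is_derive1_powR.
have h5 := is_deriveM h4 h3.
apply: (is_derive_eq h5).
rewrite /powR_onem /GRing.scale/= /comp; ring.
Qed.

Lemma continuous_powR_onem p q x : 0 < x < 1 ->
  {for x, continuous (powR_onem p q)}.
Proof.
move=> /(is_derive1_powR_onem p q) h; apply: differentiable_continuous.
by apply/derivable1_diffP; apply: ex_derive.
Qed.

Lemma powR_onem_ge0_le1 p q x : 0 <= p -> 0 <= q -> 0 < x < 1 ->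
  powR_onem p q x <= 1.
Proof.
move=> p0 q0 /andP[x0 x1]; rewrite -[leRHS]mulr1 ler_pM ?powR_ge0//.
- by rewrite powR_le1// !ltW.
- by rewrite powR_le1// !ltW ?subr_gt0// gtrBl.
Qed.

Lemma beta_densE a b x : 0 < x < 1 ->
  beta_dens a b x = powR_onem (a - 1) (b - 1) x.
Proof. by rewrite /beta_dens => ->. Qed.

Lemma beta_dens_ge0 a b x : 0 <= beta_dens a b x.
Proof. by rewrite /beta_dens; case: ifP => // _; exact: powR_onem_ge0. Qed.

Lemma beta_dens_gt0 a b x : 0 < x < 1 -> 0 < beta_dens a b x.
Proof.
move=> h; rewrite beta_densE//; case/andP: h => x0 x1.
by rewrite mulr_gt0 ?powR_gt0// subr_gt0.
Qed.

Lemma measurable_beta_dens a b : measurable_fun setT (beta_dens a b).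
Proof.
apply: measurable_fun_ifT; last exact: measurable_cst.
  by apply: measurable_and; apply: measurable_fun_ltr.
exact: measurable_powR_onem.
Qed.

Lemma emeasurable_beta_dens a b D : measurable_fun D (EFin \o beta_dens a b).
Proof. by apply/measurable_EFinP; exact: measurable_funS (measurable_beta_dens a b). Qed.

Definition betaI a b : \bar R := (\int[mu]_(x in `]0%R, 1%R[) (beta_dens a b x)%:E)%E.

Lemma betaI_ge0 a b : (0 <= betaI a b)%E.
Proof. by apply: integral_ge0 => x _; rewrite lee_fin beta_dens_ge0. Qed.

Lemma betaIE a b :
  betaI a b = (\int[mu]_(x in `]0%R, 1%R[) (powR_onem (a - 1) (b - 1) x)%:E)%E.
Proof.
apply: eq_integral => x; rewrite inE/= in_itv/= => h.
by rewrite beta_densE.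
Qed.

Lemma integral_powR01_fin a : 0 < a ->
  (\int[mu]_(x in `]0%R, 1%R[) (powR_onem (a - 1) 0 x)%:E < +oo)%E.
Proof.
move=> a0.
(* The primitive [x^a / a] is bounded by [a^-1], even when [a < 1] makes the integrand unbounded. *)
pose F x := a^-1 * powR_onem a 0 x.
have h : (\int[mu]_(x in `]0%R, 1%R[) (powR_onem (a - 1) 0 x)%:E <= (a^-1 + a^-1)%:E)%E.
  apply: (@FTC2_01_le _ F (powR_onem (a - 1) 0) a^-1).
  - exact: measurable_powR_onem.
  - by move=> x; exact: powR_onem_ge0.
  - move=> x x01; have h := is_derive1_powR_onem a 0 x01.
    have := is_deriveZ a^-1 h; rewrite mul0r subr0 /GRing.scale/= mulrA mulVf ?gt_eqF// mul1r.
    exact.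
  - by move=> x; exact: continuous_powR_onem.
  - move=> x x01; rewrite /F ger0_norm; last first.
      by apply: mulr_ge0; rewrite ?invr_ge0 ?(ltW a0)// powR_onem_ge0.
    rewrite -[leRHS]mulr1 ler_wpM2l ?invr_ge0 ?(ltW a0)//.
    by apply: powR_onem_ge0_le1 => //; exact: ltW.
exact: (le_lt_trans h (ltry _)).
Qed.

Lemma integral_onem_powR01_fin b : 0 < b ->
  (\int[mu]_(x in `]0%R, 1%R[) (powR_onem 0 (b - 1) x)%:E < +oo)%E.
Proof.
move=> a0.
pose F x := - b^-1 * powR_onem 0 b x.
have h : (\int[mu]_(x in `]0%R, 1%R[) (powR_onem 0 (b - 1) x)%:E <= (b^-1 + b^-1)%:E)%E.
  apply: (@FTC2_01_le _ F (powR_onem 0 (b - 1)) b^-1).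
  - exact: measurable_powR_onem.
  - by move=> x; exact: powR_onem_ge0.
  - move=> x x01; have h := is_derive1_powR_onem 0 b x01.
    have := is_deriveZ (- b^-1) h; rewrite mul0r sub0r /GRing.scale/= mulNr mulrN opprK mulrA mulVf ?gt_eqF// mul1r.
    exact.
  - by move=> x; exact: continuous_powR_onem.
  - move=> x x01; rewrite /F mulNr normrN ger0_norm; last first.
      by apply: mulr_ge0; rewrite ?invr_ge0 ?(ltW a0)// powR_onem_ge0.
    rewrite -[leRHS]mulr1 ler_wpM2l ?invr_ge0 ?(ltW a0)//.
    by apply: powR_onem_ge0_le1 => //; exact: ltW.
exact: (le_lt_trans h (ltry _)).
Qed.

(** The power is at most 1 for [q >= 0] and at most its value at 1/2 for [q < 0]; the sum covers
    both signs. *)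
Lemma powR_half_bound q x : 2^-1 <= x <= 1 -> x `^ q <= 1 + 2^-1 `^ q.
Proof.
move=> /andP[x0 x1].
have x00 : 0 < x by rewrite (lt_le_trans _ x0)// invr_gt0.
have [q0|q0] := leP 0 q.
  rewrite (le_trans (y := 1)) ?lerDl ?powR_ge0//.
  by rewrite powR_le1// x1 ltW.
rewrite (le_trans (y := 2^-1 `^ q)) ?lerDr//.
rewrite -[q]opprK 2![_ `^ (- - q)]powRN lef_pV2 ?posrE ?powR_gt0 ?invr_gt0//.
rewrite ge0_ler_powR// ?nnegrE ?invr_ge0// ?(ltW x00)//.
by rewrite oppr_ge0 ltW.
Qed.

(** On each half of the interval one factor is bounded by a constant, and the other is an integrable
    pure power. *)
Lemma betaI_fin a b : 0 < a -> 0 < b -> (betaI a b < +oo)%E.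
Proof.
move=> a0 b0.
pose C1 : R := 1 + 2^-1 `^ (b - 1); pose C2 : R := 1 + 2^-1 `^ (a - 1).
have C10 : 0 <= C1 by rewrite addr_ge0 ?powR_ge0.
have C20 : 0 <= C2 by rewrite addr_ge0 ?powR_ge0.
have mp p q D : measurable_fun D (EFin \o powR_onem p q).
  by apply/measurable_EFinP; exact: measurable_funS (measurable_powR_onem p q).
have mi : measurable (`]0%R, 1%R[%classic : set R) by exact: measurable_itv.
apply: (@le_lt_trans _ _ (\int[mu]_(x in `]0%R, 1%R[)
   ((C1%:E * (powR_onem (a - 1) 0 x)%:E) + (C2%:E * (powR_onem 0 (b - 1) x)%:E)))%E).
  rewrite betaIE; apply: ge0_le_integral => //.
  - by move=> x _; rewrite lee_fin powR_onem_ge0.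
  - exact: mp.
  - by apply: emeasurable_funD; apply: measurable_funeM; exact: mp.
  move=> x /=; rewrite in_itv/= => /andP[x0 x1].
  rewrite -!EFinM -EFinD lee_fin /powR_onem !powRr0 mulr1 mul1r.
  have [x2|x2] := leP x 2^-1.
    rewrite (le_trans (y := C1 * x `^ (a - 1)))//; last first.
      by rewrite lerDl mulr_ge0// powR_ge0.
    rewrite mulrC ler_wpM2r ?powR_ge0// powR_half_bound//.
    lra.
  rewrite (le_trans (y := C2 * (1 - x) `^ (b - 1)))//; last first.
    by rewrite lerDr mulr_ge0// powR_ge0.
  rewrite ler_wpM2r ?powR_ge0// powR_half_bound//.
  lra.
rewrite ge0_integralD//; last 4 first.
- by move=> x _; rewrite mule_ge0// lee_fin// powR_onem_ge0.
- by apply: measurable_funeM; exact: mp.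
- by move=> x _; rewrite mule_ge0// lee_fin// powR_onem_ge0.
- by apply: measurable_funeM; exact: mp.
rewrite !ge0_integralZl_EFin//; last 4 first.
- by move=> x _; rewrite lee_fin powR_onem_ge0.
- exact: mp.
- by move=> x _; rewrite lee_fin powR_onem_ge0.
- exact: mp.
by apply: lte_add_pinfty; apply: lte_mul_pinfty => //;
  [exact: integral_powR01_fin|exact: integral_onem_powR01_fin].
Qed.

Lemma integral_beta_dens_setI01 a b B : measurable B ->
  (\int[mu]_(x in B) (beta_dens a b x)%:E =
   \int[mu]_(x in B `&` `]0%R, 1%R[) (beta_dens a b x)%:E)%E.
Proof.
move=> mB; rewrite [RHS]integral_mkcondr; apply: eq_integral => x _.
rewrite patchE; case: ifPn => //; rewrite notin_setE/= in_itv/= => h.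
by rewrite /beta_dens (negbTE (introN idP h)).
Qed.

Lemma betaBE a b : betaB a b = fine (betaI a b).
Proof.
rewrite /betaB (@integral_beta_dens_setI01 _ _ `[0%R, 1%R]%classic)//.
rewrite setIidr// => x /=; rewrite !in_itv/=.
by move=> /andP[/ltW-> /ltW->].
Qed.

Lemma betaIEFin a b : 0 < a -> 0 < b -> betaI a b = (betaB a b)%:E.
Proof.
by move=> a0 b0; rewrite betaBE fineK// ge0_fin_numE ?betaI_ge0// betaI_fin.
Qed.

Lemma integral_beta_dens_gt0 a b s t : 0 <= s -> s < t -> t <= 1 ->
  (0 < \int[mu]_(x in `]s, t[) (beta_dens a b x)%:E)%E.
Proof.
move=> s0 st t1.
have mst : measurable (`]s, t[%classic : set R) by exact: measurable_itv.
rewrite lt0e integral_ge0 ?andbT; last by move=> x _; rewrite lee_fin beta_dens_ge0.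
(* A zero integral would make the density vanish almost everywhere on an interval of length
   [t - s > 0] where it is positive. *)
apply/eqP => h0.
have : (\int[mu]_(x in `]s, t[) `|(beta_dens a b x)%:E| = 0)%E.
  rewrite -h0; apply: eq_integral => x _.
  by rewrite gee0_abs// lee_fin beta_dens_ge0.
move/(ae_eq_integral_abs mu mst (@emeasurable_beta_dens a b _)) => [A [mA A0 Ah]].
suff : (mu `]s, t[%classic <= mu A)%E.
  by rewrite A0 lebesgue_measure_itv/= lte_fin st -EFinD lee_fin subr_le0 leNgt st.
apply: le_measure; rewrite ?inE// => x sx; apply: Ah => /= /(_ sx).
move: sx; rewrite /= in_itv/= => /andP[sx xt] /eqP; rewrite eqe gt_eqF//.
by rewrite beta_dens_gt0// (le_lt_trans s0 sx) (lt_le_trans xt t1).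
Qed.

Lemma betaB_gt0 a b : 0 < a -> 0 < b -> 0 < betaB a b.
Proof.
move=> a0 b0; rewrite -lte_fin -betaIEFin//.
exact: integral_beta_dens_gt0.
Qed.

Lemma powR_harmonic_cvg0 b : 0 < b ->
  ((n.+3%:R^-1 : R) `^ b) @[n --> \oo] --> (0 : R).
Proof.
move=> b0; have /cvg_at_rightP h := powR_cvg0 b0.
apply: (h (fun n : nat => n.+3%:R^-1)); split; first by move=> n; rewrite invr_gt0.
rewrite (_ : (fun n : nat => _) = (fun n => harmonic (n + 2)%N)).
  by rewrite (cvg_shiftn 2 (@harmonic R)); exact: cvg_harmonic.
by apply/funext => n; rewrite /harmonic addn2.
Qed.

(** Integrate the derivative of [x^a (1 - x)^b] over [itv01 n] and let [n] grow: the boundary value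
    at the lower end [e] enters with a minus sign, and the one at [1 - e] is at most [e^b], which
    tends to 0. *)
Lemma beta_mean_ineq a b : 0 < a -> 0 < b ->
  a * betaB a (b + 1) <= b * betaB (a + 1) b.
Proof.
move=> a0 b0.
have a10 : 0 < a + 1 by rewrite ltr_pwDl.
have b10 : 0 < b + 1 by rewrite ltr_pwDl.
suff : (a%:E * betaI a (b + 1) <= b%:E * betaI (a + 1) b)%E.
  by rewrite (betaIEFin a0 b10) (betaIEFin a10 b0) -!EFinM lee_fin.
rewrite (betaIE a (b + 1)) (betaIE (a + 1) b) (addrK 1 a) (addrK 1 b).
have mp p q D : measurable_fun D (EFin \o powR_onem p q).
  by apply/measurable_EFinP; exact: measurable_funS (measurable_powR_onem p q).
have lim1 := cvgeZl (y := a%:E) _ (cvg_integral_itv01 (measurable_powR_onem (a - 1) b)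
  (powR_onem_ge0 (a - 1) b)).
have {}lim1 := lim1 isT.
set B2 := (\int[mu]_(x in `]0%R, 1%R[) (powR_onem a (b - 1) x)%:E)%E.
have lim2 : ((b%:E * B2 + ((n.+3%:R^-1 : R) `^ b)%:E)%E @[n --> \oo] --> (b%:E * B2)%E).
  rewrite -[X in _ --> X]adde0; apply: cvgeD => //.
  - by rewrite fin_num_adde_defl.
  - exact: cvg_cst.
  - apply/cvg_EFin; first exact: nearW.
    exact: (powR_harmonic_cvg0 b0).
apply: (lee_cvg_to lim1 lim2); apply: nearW => n.
have [e0 e1 e2] := @itv01_bounds R n.
set e := n.+3%:R^-1 in e0 e1 e2 *.
have mI : measurable (itv01 n : set R) by exact: measurable_itv.
have i01 x : itv01 n x -> 0 < x < 1.
  by rewrite /itv01/= in_itv/= => /andP[h1 h2]; rewrite (lt_le_trans e0 h1) (le_lt_trans h2 e2).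
have Iint p q : mu.-integrable (itv01 n) (EFin \o powR_onem p q).
  apply: continuous_compact_integrable; first exact: segment_compact.
  by apply: continuous_in_subspaceT => x; rewrite inE => /i01; exact: continuous_powR_onem.
have FTC := @FTC2_oo01 _ (powR_onem a b)
  (fun x => a * powR_onem (a - 1) b x - b * powR_onem a (b - 1) x).
have {}FTC := FTC (@is_derive1_powR_onem a b).
have {}FTC := FTC _ _ _ e0 e1 e2.
have cc (x : R) : 0 < x < 1 -> {for x, continuous (fun x => a * powR_onem (a - 1) b x - b * powR_onem a (b - 1) x)}.
  move=> x01; apply: continuousB; apply: continuousM; try exact: cvg_cst; exact: continuous_powR_onem.
have {FTC} := FTC cc.
rewrite -/(itv01 n) (_ : (\int[mu]_(x in _) _)%E =
  (a%:E * \int[mu]_(x in itv01 n) (powR_onem (a - 1) b x)%:E -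
   b%:E * \int[mu]_(x in itv01 n) (powR_onem a (b - 1) x)%:E)%E); last first.
  rewrite -!integralZl//; last 2 first.
    exact: Iint.
    exact: Iint.
  rewrite -integralB//.
  - exact: (@integrableZl _ _ _ mu _ mI a _ (Iint (a - 1) b)).
  - exact: (@integrableZl _ _ _ mu _ mI b _ (Iint a (b - 1))).
move=> FTC.
have bfin : (b%:E * \int[mu]_(x in itv01 n) (powR_onem a (b - 1) x)%:E)%E \is a fin_num.
  by apply: fin_numM => //; apply: integrable_fin_num => //; exact: Iint.
rewrite -[X in (X <= _)%E](subeK _ bfin) FTC.
rewrite addeC leeD//.
  apply: lee_wpmul2l; first by rewrite lee_fin ltW.
  apply: ge0_subset_integral.
  - exact: mI.
  - exact: measurable_itv.
  - exact: mp.
  - by move=> x _; rewrite lee_fin powR_onem_ge0.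
  - by move=> x /i01; rewrite /= in_itv.
rewrite lee_fin (le_trans (y := powR_onem a b (1 - e)))//.
  by rewrite gerBl powR_onem_ge0.
rewrite /powR_onem (_ : 1 - (1 - e) = e); last by ring.
rewrite ler_piMl ?powR_ge0//.
by rewrite powR_le1// ?(ltW a0)// !ltW// (lt_trans e0 e1).
Unshelve. all: end_near. Qed.

End BetaDensity.

(** * Beta distributions and the transition kernel *)

Section BetaDistribution.
Context {R : realType}.
Notation mu := (@lebesgue_measure R).
Implicit Types (a b x : R) (A B : set R).

(** Multiply the density by [x + (1 - x) = 1]. *)
Lemma betaB_split a b : 0 < a -> 0 < b ->
  betaB a b = betaB (a + 1) b + betaB a (b + 1).
Proof.
move=> a0 b0.
have a10 : 0 < a + 1 by rewrite ltr_pwDl.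
have b10 : 0 < b + 1 by rewrite ltr_pwDl.
suff : (betaI a b = betaI (a + 1) b + betaI a (b + 1))%E.
  by rewrite (betaIEFin a0 b0) (betaIEFin a0 b10) (betaIEFin a10 b0) -EFinD => -[].
rewrite /betaI -ge0_integralD//; last 4 first.
- by move=> x _; rewrite lee_fin beta_dens_ge0.
- exact: emeasurable_beta_dens.
- by move=> x _; rewrite lee_fin beta_dens_ge0.
- exact: emeasurable_beta_dens.
apply: eq_integral => x; rewrite inE/= in_itv/= => h.
rewrite -EFinD !beta_densE// !addrK /powR_onem; congr EFin.
case/andP: h => x0 x1.
rewrite -(mulr_powRB1 (ltW x0) a0).
have y0 : 0 <= 1 - x by rewrite subr_ge0 ltW.
by rewrite -(mulr_powRB1 y0 b0); ring.
Qed.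

(** The quotient [betaB a (b + 1) / betaB a b] is the mean of [1 - V] for [V] of law Beta(a, b). *)
Lemma beta_mean a b : 0 < a -> 0 < b ->
  betaB a (b + 1) <= b / (a + b) * betaB a b.
Proof.
move=> a0 b0; rewrite mulrAC ler_pdivlMr ?addr_gt0//.
have := beta_mean_ineq a0 b0; rewrite (betaB_split a0 b0).
by set X := betaB (a + 1) b; set Y := betaB a (b + 1); lra.
Qed.

Lemma integral_beta_dens_fin a b B : 0 < a -> 0 < b -> measurable B ->
  (0 <= \int[mu]_(x in B) (beta_dens a b x)%:E <= (betaB a b)%:E)%E.
Proof.
move=> a0 b0 mB; apply/andP; split.
  by apply: integral_ge0 => x _; rewrite lee_fin beta_dens_ge0.
rewrite integral_beta_dens_setI01// -betaIEFin//.
apply: ge0_subset_integral => //.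
- exact: measurableI.
- exact: emeasurable_beta_dens.
- by move=> x _; rewrite lee_fin beta_dens_ge0.
Qed.

Definition beta_pr a b B : R := fine (betaL a b B).

Lemma beta_pr_fin a b B : 0 < a -> 0 < b -> measurable B ->
  betaL a b B = (beta_pr a b B)%:E.
Proof.
move=> a0 b0 mB; rewrite /beta_pr fineK// /betaL.
have /andP[h1 h2] := integral_beta_dens_fin a0 b0 mB.
by rewrite fin_numM// ge0_fin_numE// (le_lt_trans h2)// ltry.
Qed.

Lemma beta_prE a b B : 0 < a -> 0 < b -> measurable B ->
  (\int[mu]_(x in B) (beta_dens a b x)%:E = (beta_pr a b B * betaB a b)%:E)%E.
Proof.
move=> a0 b0 mB; rewrite EFinM -beta_pr_fin// /betaL -muleA -EFinM.
by rewrite mulVf ?mule1// gt_eqF ?betaB_gt0.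
Qed.

Lemma beta_pr_ge0 a b B : 0 < a -> 0 < b -> measurable B -> 0 <= beta_pr a b B.
Proof.
move=> a0 b0 mB; have /andP[h _] := integral_beta_dens_fin a0 b0 mB.
by move: h; rewrite beta_prE// lee_fin pmulr_lge0 ?betaB_gt0.
Qed.

Lemma beta_pr_le1 a b B : 0 < a -> 0 < b -> measurable B -> beta_pr a b B <= 1.
Proof.
move=> a0 b0 mB; have /andP[_ h] := integral_beta_dens_fin a0 b0 mB.
by move: h; rewrite beta_prE// lee_fin ger_pMl ?betaB_gt0.
Qed.

Lemma le_beta_pr a b A B : 0 < a -> 0 < b -> measurable A -> measurable B ->
  A `<=` B -> beta_pr a b A <= beta_pr a b B.
Proof.
move=> a0 b0 mA mB AB.
rewrite -(ler_pM2r (betaB_gt0 a0 b0)) -lee_fin -!beta_prE//.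
apply: ge0_subset_integral => //; first exact: emeasurable_beta_dens.
by move=> x _; rewrite lee_fin beta_dens_ge0.
Qed.

Lemma beta_pr_sub01 a b B : 0 < a -> 0 < b -> measurable B ->
  `]0, 1[ `<=` B -> beta_pr a b B = 1.
Proof.
move=> a0 b0 mB h; apply/eqP; rewrite eq_le beta_pr_le1//=.
rewrite -(ler_pM2r (betaB_gt0 a0 b0)) mul1r -lee_fin -beta_prE// -betaIEFin//.
by rewrite integral_beta_dens_setI01// setIidr.
Qed.

Lemma beta_pr_disj01 a b B : 0 < a -> 0 < b -> measurable B ->
  B `&` `]0, 1[ = set0 -> beta_pr a b B = 0.
Proof.
move=> a0 b0 mB h; apply: (mulIf (lt0r_neq0 (betaB_gt0 a0 b0))).
rewrite mul0r; apply: EFin_inj; rewrite -beta_prE// integral_beta_dens_setI01// h.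
by rewrite integral_set0.
Qed.

Lemma beta_pr_itv_gt0 a b s t : 0 < a -> 0 < b -> 0 <= s -> s < t -> t <= 1 ->
  0 < beta_pr a b `]s, t[.
Proof.
move=> a0 b0 s0 st t1; rewrite -(pmulr_lgt0 _ (betaB_gt0 a0 b0)) -lte_fin -beta_prE//.
exact: integral_beta_dens_gt0.
Qed.

(** For [x] in [0, 1], membership means [l / n < 1 - x]. Hence the proportion of layers [l < n] that
    contain [x] approximates [1 - x] from above within [1 / n], which turns the mean of [1 - x] into
    a sum of probabilities of intervals. *)
Definition layer (n l : nat) : set R := `[0, 1 - l%:R / n%:R[.

Lemma measurable_layer n l : measurable (layer n l).
Proof. exact: measurable_itv. Qed.

Lemma layer_sum_bounds (n : nat) x : (0 < n)%N -> 0 <= x <= 1 ->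
  n%:R * (1 - x) <= \sum_(l < n) (\1_(layer n l) x : R) <= n%:R * (1 - x) + 1.
Proof.
move=> n0 /andP[x0 x1].
set y : R := n%:R * (1 - x).
have nR : 0 < n%:R :> R by rewrite ltr0n.
have yn : 0 <= y <= n%:R.
  by rewrite mulr_ge0 ?ler0n ?subr_ge0//= ler_piMr ?ler0n// gerBl.
have E l : \1_(layer n l) x = ((l%:R : R) < y)%R%:R :> R.
  rewrite indicE /layer; congr (nat_of_bool _)%:R.
  rewrite mem_setE in_itv/= x0/= ltrBrDr -ltrBrDl ltr_pdivrMr// [_ * n%:R]mulrC.
  by [].
under eq_bigr do rewrite E.
(* Counting the naturals below [m] that are less than [y]; at [m = n] the lower bound is [y] itself,
   as [y <= n]. *)
have H m : Num.min y m%:R <= \sum_(l < m) (((l%:R : R) < y)%R%:R : R) <= Num.min (y + 1) m%:R.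
  elim: m => [|m /andP[IH1 IH2]].
    by rewrite big_ord0 !ge_min !le_min lexx; case/andP: yn => ? ?; rewrite orbT addr_ge0.
  rewrite big_ord_recr/=; have := IH1; have := IH2.
  set S := \sum_(i < m) _; rewrite !le_min !ge_min -natr1.
  have [h|h] /= := ltP m%:R y.
    move=> /andP[h1 h2] /orP[]h3.
      by apply/andP; split; [apply/orP; left; lra|apply/andP; split; lra].
    by apply/andP; split; [apply/orP; right; lra|apply/andP; split; lra].
  rewrite addr0 => /andP[h1 h2] /orP h3.
  by apply/andP; split; [case: h3 => h4; apply/orP; left; lra|apply/andP; split; lra].
have /andP[h1 h2] := H n.
move: h1 h2; rewrite le_min ge_min => h1 /andP[h2 _]; rewrite h2 andbT.
by case/andP: yn => _ yn; case/orP: h1 => // h1; exact: le_trans yn h1.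
Qed.

(** The left side is the mean number of layers containing a Beta(a, b) variable [V]; this number is
    at most [n (1 - V) + 1], and [beta_mean] bounds the mean of [1 - V]. *)
Lemma beta_layer_sum a b n : 0 < a -> 0 < b -> (0 < n)%N ->
  \sum_(l < n) beta_pr a b (layer n l) <= n%:R * (b / (a + b)) + 1.
Proof.
move=> a0 b0 n0.
have b10 : 0 < b + 1 by rewrite ltr_pwDl.
have mi : measurable (`]0%R, 1%R[%classic : set R) by exact: measurable_itv.
rewrite -(ler_pM2r (betaB_gt0 a0 b0)) mulr_suml.
apply: (@le_trans _ _ (n%:R * betaB a (b + 1) + betaB a b)); last first.
  rewrite mulrDl mul1r lerD2r -mulrA ler_wpM2l ?ler0n//; exact: beta_mean.
rewrite -lee_fin EFinD EFinM -sumEFin -betaIEFin// -betaIEFin//.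
under eq_bigr => l _.
  rewrite -beta_prE//; last exact: measurable_layer.
  rewrite integral_beta_dens_setI01; last exact: measurable_layer.
  rewrite integral_mkcondl; over.
rewrite /= -ge0_integral_sum//; last 2 first.
- move=> l; apply/measurable_restrict => //; first exact: measurable_layer.
  by apply: emeasurable_beta_dens.
- by move=> l x _; apply: erestrict_ge0 => y _; rewrite lee_fin beta_dens_ge0.
rewrite /betaI -ge0_integralZl_EFin//; last 2 first.
- by move=> x _; rewrite lee_fin beta_dens_ge0.
- exact: emeasurable_beta_dens.
rewrite -ge0_integralD//; last 4 first.
- by move=> x _; rewrite mule_ge0// lee_fin beta_dens_ge0.
- by apply: measurable_funeM; exact: emeasurable_beta_dens.
- by move=> x _; rewrite lee_fin beta_dens_ge0.
- exact: emeasurable_beta_dens.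
apply: ge0_le_integral => //.
- move=> x _; apply: sume_ge0 => l _.
  by apply: erestrict_ge0 => y _; rewrite lee_fin beta_dens_ge0.
- apply: emeasurable_sum => l; apply/measurable_restrict => //; first exact: measurable_layer.
  by apply: emeasurable_beta_dens.
- apply: emeasurable_funD; last exact: emeasurable_beta_dens.
  by apply: measurable_funeM; exact: emeasurable_beta_dens.
move=> x /=; rewrite in_itv/= => h; have /andP[x0 x1] := h.
have x01 : 0 <= x <= 1 by rewrite !ltW.
have /andP[_ hl] := layer_sum_bounds n0 x01.
apply: (@le_trans _ _ ((\sum_(l < n) (\1_(layer n l) x : R)) * beta_dens a b x)%:E).
  rewrite mulr_suml -sumEFin lee_sum// => l _; rewrite patchE indicE.
  by case: ifPn => _; rewrite ?mul1r ?mul0r.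
apply: (@le_trans _ _ ((n%:R * (1 - x) + 1) * beta_dens a b x)%:E).
  by rewrite lee_fin ler_wpM2r ?beta_dens_ge0.
rewrite -EFinM -EFinD lee_fin mulrDl mul1r lerD2r -mulrA ler_wpM2l ?ler0n//.
rewrite !beta_densE// addrK /powR_onem mulrCA ler_wpM2l ?powR_ge0//.
by rewrite mulr_powRB1// subr_ge0 ltW.
Qed.

End BetaDistribution.

(** The preimage of a ray under a monotone map is an interval. *)
Lemma nondecreasing_measurable {R : realType} (f : R -> R) :
  {homo f : x y / x <= y} -> measurable_fun setT f.
Proof.
move=> ndf; apply: (measurability _ (RGenOInfty.measurableE R)).
move=> _ [_ [r ->] <-]; rewrite setTI; apply: is_interval_measurable.
move=> x y /=; rewrite !in_itv/= !andbT => rx _ z /andP[xz _].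
by rewrite in_itv/= andbT; apply: (lt_le_trans rx); exact: ndf.
Qed.

(** * The binomial mixture kernel and its bounds uniform in the state *)

Section Kernel.
Context {R : realType}.
Implicit Types (a b u v : R) (B : set R).

Lemma betaFE a b v : betaF a b v = beta_pr a b `]-oo, v].
Proof. by []. Qed.

Lemma betaF01 a b v : 0 < a -> 0 < b -> 0 <= betaF a b v <= 1.
Proof. by move=> a0 b0; rewrite betaFE beta_pr_ge0// beta_pr_le1. Qed.

Lemma betaF1 a b : 0 < a -> 0 < b -> betaF a b 1 = 1.
Proof.
move=> a0 b0; rewrite betaFE beta_pr_sub01// => x /=.
by rewrite !in_itv/= => /andP[_ /ltW].
Qed.

Lemma le_betaF a b : 0 < a -> 0 < b -> {homo betaF a b : x y / x <= y}.
Proof.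
move=> a0 b0 x y xy; rewrite !betaFE le_beta_pr// => z /=.
by rewrite !in_itv/= => /le_trans; exact.
Qed.

Lemma betaFinv01 a b u : 0 < a -> 0 < b -> u <= 1 -> 0 <= betaFinv a b u <= 1.
Proof.
move=> a0 b0 u1; rewrite /betaFinv; set S := [set _ | _].
(* Since [betaF a b 1 = 1], the set is nonempty and its infimum is not a default value. *)
have S1 : S 1 by split; rewrite ?ler01 ?lexx// betaF1.
have lS : lbound S 0 by move=> x [/andP[]].
apply/andP; split; first by apply: lb_le_inf => //; exists 1.
by apply: ge_inf => //; exists 0.
Qed.

Lemma le_betaFinv a b u u' : 0 < a -> 0 < b -> u <= u' -> u' <= 1 ->
  betaFinv a b u <= betaFinv a b u'.
Proof.
move=> a0 b0 uu' u'1; rewrite /betaFinv.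
apply: lb_le_inf; first by exists 1; split; rewrite ?ler01 ?lexx// betaF1.
move=> x [x01 u'F]; apply: ge_inf; first by exists 0 => y [/andP[]].
by split => //; exact: le_trans uu' u'F.
Qed.

Section Markov.
Variables (N : nat) (al be : nat -> R).
Hypotheses (hal : forall j, 0 < al j) (hbe : forall j, 0 < be j).

Lemma Ups01 j v : 0 <= Ups al be j v <= 1.
Proof. by apply: betaFinv01 => //; have /andP[] := betaF01 v (hal j) (hbe j). Qed.

Lemma measurable_Ups j : measurable_fun setT (Ups al be j).
Proof.
apply: nondecreasing_measurable => x y xy; apply: le_betaFinv => //.
  exact: le_betaF.
by have /andP[] := betaF01 y (hal j) (hbe j).
Qed.

Definition binom_weight u (z : nat) : R := 'C(N, z)%:R * u ^+ z * (1 - u) ^+ (N - z).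

Lemma binom_weight_ge0 u z : 0 <= u <= 1 -> 0 <= binom_weight u z.
Proof.
move=> /andP[u0 u1]; rewrite /binom_weight.
by rewrite !mulr_ge0 ?ler0n ?exprn_ge0// subr_ge0.
Qed.

Lemma sum_binom_weight u : \sum_(z < N.+1) binom_weight u z = 1.
Proof.
rewrite -[RHS](expr1n _ N) -[in RHS](subrK u 1) exprDn; apply: eq_bigr => z _.
by rewrite /binom_weight -mulr_natl; ring.
Qed.

Definition beta_mix j B (z : nat) : R :=
  beta_pr (al j.+1 + z%:R) (be j.+1 + (N - z)%:R) B.

Definition kern j v B : R :=
  \sum_(z < N.+1) binom_weight (Ups al be j v) z * beta_mix j B z.

Lemma al_pos j z : 0 < al j + z%:R. Proof. by rewrite ltr_pwDl. Qed.
Lemma be_pos j z : 0 < be j + z%:R. Proof. by rewrite ltr_pwDl. Qed.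

Lemma bmsb_kernelE j v B : measurable B ->
  bmsb_kernel N al be j v B = (kern j v B)%:E.
Proof.
move=> mB; rewrite /bmsb_kernel /kern -sumEFin; apply: eq_bigr => z _.
by rewrite beta_pr_fin ?al_pos ?be_pos.
Qed.

Lemma measurable_kern j B : measurable_fun setT (fun v => kern j v B).
Proof.
apply: measurable_sum => z; apply: measurable_funM; last exact: measurable_cst.
apply: measurable_funM; first apply: measurable_funM => //.
  by apply: measurable_funX; exact: measurable_Ups.
apply: measurable_funX; apply: measurable_funB => //; exact: measurable_Ups.
Qed.

(** The kernel is a convex combination of beta probabilities in which only the weights depend on
    [v], so a bound shared by all components is uniform in the state. *)
Lemma kern_ge j v B c : (forall z, (z <= N)%N -> c <= beta_mix j B z) ->
  c <= kern j v B.
Proof.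
move=> h; rewrite -[leLHS]mul1r -(sum_binom_weight (Ups al be j v)) mulr_suml.
apply: ler_sum => z _; rewrite ler_wpM2l ?binom_weight_ge0 ?Ups01//.
by apply: h; rewrite -ltnS.
Qed.

Lemma kern_ge0 j v B : measurable B -> 0 <= kern j v B.
Proof.
by move=> mB; apply: kern_ge => z _; rewrite beta_pr_ge0 ?al_pos ?be_pos.
Qed.

Lemma kern_disj01 j v B : measurable B -> B `&` `]0, 1[ = set0 -> kern j v B = 0.
Proof.
move=> mB h; apply: big1 => z _.
by rewrite /beta_mix beta_pr_disj01 ?mulr0 ?al_pos ?be_pos.
Qed.

Lemma kern_itv_gt0 j s t : 0 <= s -> s < t -> t <= 1 ->
  exists2 c : R, 0 < c & forall v, c <= kern j v `]s, t[.
Proof.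
move=> s0 st t1.
pose g (z : nat) := beta_mix j `]s, t[ z.
have g0 z : 0 < g z by apply: beta_pr_itv_gt0; rewrite ?al_pos ?be_pos.
(* The least of finitely many positive component probabilities (and 1). *)
pose c : R := \big[Num.min/1]_(z < N.+1) g z.
exists c.
  by rewrite /c; elim/big_ind : _ => // x y x0 y0; rewrite lt_min x0.
move=> v; apply: kern_ge => z zN.
have zN' : (z < N.+1)%N by rewrite ltnS.
by rewrite /c (bigD1 (Ordinal zN'))//= ge_min lexx.
Qed.

(** The component of index [z] gives [1 - V] the mean [(b + N - z) / (a + b + N)], which is largest
    at [z = 0]; averaging with the binomial weights keeps this bound. *)
Lemma kern_layer_sum j v n : (0 < n)%N ->
  \sum_(l < n) kern j v (layer n l) <=
  n%:R * (1 - al j.+1 / (al j.+1 + be j.+1 + N%:R)) + 1.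
Proof.
move=> n0; rewrite /kern exchange_big/=.
set a := al j.+1; set b := be j.+1.
have a0 : 0 < a by exact: hal.
have b0 : 0 < b by exact: hbe.
set C := (X in _ <= X).
apply: (@le_trans _ _ (\sum_(z < N.+1) binom_weight (Ups al be j v) z * C)); last first.
  by rewrite -mulr_suml sum_binom_weight mul1r.
apply: ler_sum => z _; rewrite -mulr_sumr ler_wpM2l ?binom_weight_ge0 ?Ups01//.
apply: (le_trans (beta_layer_sum (al_pos j.+1 z) (be_pos j.+1 (N - z)) n0)).
rewrite /C lerD2r ler_wpM2l ?ler0n// -/a -/b.
have zN : (z <= N)%N by rewrite -ltnS.
have -> : a + z%:R + (b + (N - z)%:R) = a + b + N%:R.
  by rewrite -[in RHS](subnKC zN) natrD; ring.
have d0 : 0 < a + b + N%:R by rewrite ltr_pwDl// addr_gt0.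
rewrite lerBrDr -mulrDl ler_pdivrMr// mul1r natrB//; have : 0 <= z%:R :> R by [].
by lra.
Qed.

End Markov.
End Kernel.

(** * Stick-breaking sequences *)

Section StickWeights.
Context {R : realType}.
Implicit Types u : nat -> R.

Definition stick_rem_seq u l : R := \prod_(i < l) (1 - u i).
Definition stick_seq u l : R := u l * stick_rem_seq u l.

Lemma sum_stick_seq u n : \sum_(j < n) stick_seq u j = 1 - stick_rem_seq u n.
Proof.
elim: n => [|n IH]; first by rewrite /stick_rem_seq !big_ord0 subrr.
by rewrite big_ord_recr/= IH /stick_seq /stick_rem_seq big_ord_recr/=; ring.
Qed.

Lemma stick_rem_seq01 u l : (forall i, 0 <= u i <= 1) -> 0 <= stick_rem_seq u l <= 1.
Proof.
move=> h; apply/andP; split.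
  by apply: prodr_ge0 => i _; case/andP: (h i) => _; rewrite subr_ge0.
apply: prodr_ile1 => i _; case/andP: (h i) => h0 h1.
by rewrite subr_ge0 h1 gerBl h0.
Qed.

Lemma stick_rem_seq_dist u u' (e : R) l :
  (forall i, 0 <= u i <= 1) -> (forall i, 0 <= u' i <= 1) ->
  (forall i, (i < l)%N -> `|u i - u' i| <= e) ->
  `|stick_rem_seq u l - stick_rem_seq u' l| <= l%:R * e.
Proof.
move=> hu hu'; elim: l => [|l IH] he.
  by rewrite /stick_rem_seq !big_ord0 subrr normr0 mul0r.
have {IH} := IH (fun i il => he i (ltnW il)); have := he l (ltnSn l).
have /andP[r0 r1] := stick_rem_seq01 l hu; have /andP[r0' r1'] := stick_rem_seq01 l hu'.
have /andP[a0 a1] := hu l; have /andP[b0 b1] := hu' l.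
rewrite /stick_rem_seq !big_ord_recr/= -/(stick_rem_seq u l) -/(stick_rem_seq u' l).
set r := stick_rem_seq u l in r0 r1 *; set r' := stick_rem_seq u' l in r0' r1' *.
move=> h1 h2.
(* Change one factor at a time: all factors lie in [0, 1], so the errors at most add up. *)
have -> : r * (1 - u l) - r' * (1 - u' l) = (r - r') * (1 - u l) - r' * (u l - u' l) by ring.
apply: le_trans (ler_normB _ _) _; rewrite !normrM -natr1 mulrDl mul1r.
apply: lerD; last by rewrite (ger0_norm r0'); apply: le_trans h1; rewrite ler_piMl.
rewrite (ger0_norm (_ : 0 <= 1 - u l)) ?subr_ge0//.
by apply: le_trans h2; rewrite ler_piMr// gerBl.
Qed.

Lemma stick_seq_dist u u' (e : R) l :
  (forall i, 0 <= u i <= 1) -> (forall i, 0 <= u' i <= 1) ->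
  (forall i, (i <= l)%N -> `|u i - u' i| <= e) ->
  `|stick_seq u l - stick_seq u' l| <= l.+1%:R * e.
Proof.
move=> hu hu' he.
have h2 := stick_rem_seq_dist hu hu' (fun i il => he i (ltnW il)).
have h1 := he l (leqnn l).
have /andP[r0' r1'] := stick_rem_seq01 l hu'; have /andP[a0 a1] := hu l.
rewrite /stick_seq; set r := stick_rem_seq u l in h2 *; set r' := stick_rem_seq u' l in h2 r0' r1' *.
have -> : u l * r - u' l * r' = u l * (r - r') + (u l - u' l) * r' by ring.
apply: le_trans (ler_normD _ _) _; rewrite !normrM -natr1 mulrDl mul1r.
apply: lerD; first by rewrite (ger0_norm a0); apply: le_trans h2; rewrite ler_piMl.
by rewrite (ger0_norm r0'); apply: le_trans h1; rewrite ler_piMr.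
Qed.

(* Where the earlier weights already exhaust the mass this is 0 / 0 = 0, as it should be. *)
Definition stick_inv (q : nat -> R) l : R := q l / (1 - \sum_(i < l) q i).

(** * Sticks that realise prescribed weights *)

Section Inverse.
Variables (m : nat) (q : nat -> R).
Hypotheses (q0 : forall l, 0 <= q l) (qm : forall l, (m <= l)%N -> q l = 0)
  (q1 : \sum_(l < m) q l = 1).

Lemma sum_weights_le1 l : \sum_(i < l) q i <= 1.
Proof.
(* Summing up to [l + m] covers both the first [l] weights and all the nonzero ones. *)
have -> : 1 = \sum_(i < l + m) q i.
  by rewrite addnC big_split_ord/= q1 big1 ?addr0// => i _; rewrite qm// leq_addr.
by rewrite big_split_ord/= lerDl sumr_ge0.
Qed.

Lemma stick_inv01 l : 0 <= stick_inv q l <= 1.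
Proof.
have h := sum_weights_le1 l; have := sum_weights_le1 l.+1; rewrite big_ord_recr/= => h'.
rewrite /stick_inv divr_ge0 ?subr_ge0//=.
have [e|e] := eqVneq (1 - \sum_(i < l) q i) 0; first by rewrite e invr0 mulr0 ler01.
have e0 : 0 < 1 - \sum_(i < l) q i by rewrite lt_neqAle eq_sym e subr_ge0.
by rewrite ler_pdivrMr// mul1r lerBrDl.
Qed.

Lemma stick_rem_seq_inv l : stick_rem_seq (stick_inv q) l = 1 - \sum_(i < l) q i.
Proof.
rewrite /stick_rem_seq; elim: l => [|l IH]; first by rewrite !big_ord0 subr0.
have h := sum_weights_le1 l; have := sum_weights_le1 l.+1.
rewrite !big_ord_recr/= IH /stick_inv; set s := \sum_(i < l) q i in h * => h'.
(* If no mass is left, [q l] must be 0, since the partial sums never exceed 1. *)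
have [e|e] := eqVneq (1 - s) 0.
  rewrite e mul0r; have := q0 l; lra.
by rewrite mulrBr mulr1 mulrCA mulfV// mulr1 opprD addrA.
Qed.

Lemma stick_seq_inv l : stick_seq (stick_inv q) l = q l.
Proof.
rewrite /stick_seq stick_rem_seq_inv /stick_inv.
have h := sum_weights_le1 l; have := sum_weights_le1 l.+1.
rewrite big_ord_recr/=; set s := \sum_(i < l) q i in h * => h'.
have [e|e] := eqVneq (1 - s) 0; last by rewrite divfK.
by rewrite e mulr0; have := q0 l; lra.
Qed.

End Inverse.

(** Both the sticks after the first [m] and the mass given to [c] amount to at most
    [stick_rem_seq u m], and each is multiplied by values bounded by [M]. The remainder is not
    assumed to tend to 0, so properness is not presupposed. *)
Lemma stick_limit_dist u (g : nat -> R) (c M : R) m : (forall i, 0 <= u i <= 1) ->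
  (forall i, `|g i| <= M) -> `|c| <= M ->
  `|limn (fun n => \sum_(j < n) (stick_seq u j * g j))
    + (1 - limn (fun n => \sum_(j < n) stick_seq u j)) * c
    - \sum_(j < m) (stick_seq u j * g j)| <= 2 * M * stick_rem_seq u m.
Proof.
move=> hu hg hc.
have M0 : 0 <= M by exact: le_trans (normr_ge0 _) hc.
have sumE n := sum_stick_seq u n.
have r01 n := stick_rem_seq01 n hu.
have w0 j : 0 <= stick_seq u j by rewrite mulr_ge0//; [case/andP: (hu j)|case/andP: (r01 j)].
have tail n : (m <= n)%N ->
    `|\sum_(j < n) (stick_seq u j * g j) - \sum_(j < m) (stick_seq u j * g j)|
    <= M * stick_rem_seq u m.
  move=> /subnKC <-; set p := (n - m)%N; rewrite big_split_ord/= addrAC subrr add0r.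
  apply: le_trans (ler_norm_sum _ _ _) _.
  apply: (@le_trans _ _ (M * \sum_(i < p) stick_seq u (m + i))).
    rewrite mulr_sumr; apply: ler_sum => i _.
    by rewrite normrM (ger0_norm (w0 _)) mulrC ler_wpM2r.
  rewrite ler_wpM2l//; have := sumE (m + p)%N; rewrite big_split_ord/= sumE => h.
  have /andP[r0 _] := r01 (m + p)%N; move: h; set S := \sum_(i < p) _; lra.
have mono : {homo (fun n => \sum_(j < n) stick_seq u j) : n p / (n <= p)%N >-> n <= p}.
  apply/nondecreasing_seqP => n; rewrite big_ord_recr/= lerDl; exact: w0.
have cw : cvgn (fun n => \sum_(j < n) stick_seq u j).
  apply: nondecreasing_is_cvgn => //; exists 1 => _ [n _ <-].
  by rewrite sumE gerBl; case/andP: (r01 n).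
(* Absolute convergence: the sums of absolute values are bounded by [M]. *)
have cg : cvgn (fun n => \sum_(j < n) (stick_seq u j * g j)).
  have -> : (fun n => \sum_(j < n) (stick_seq u j * g j)) = series (fun j => stick_seq u j * g j).
    by apply/funext => n; rewrite /series/= big_mkord.
  apply: normed_cvg; apply: nondecreasing_is_cvgn.
    apply/nondecreasing_seqP => n; rewrite [leRHS]big_nat_recr//=.
    by rewrite lerDl normr_ge0.
  exists M => _ [n _ <-].
  rewrite (_ : _ n = \sum_(j < n) `|stick_seq u j * g j|); last first.
    by rewrite -(big_mkord predT (fun j => `|stick_seq u j * g j|)).
  apply: (@le_trans _ _ (\sum_(j < n) stick_seq u j * M)).
    by apply: ler_sum => j _; rewrite normrM (ger0_norm (w0 j)) ler_wpM2l.
  rewrite -mulr_suml sumE ler_piMl// gerBl; by case/andP: (r01 n).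
have hl : `|limn (fun n => \sum_(j < n) (stick_seq u j * g j)) -
    \sum_(j < m) (stick_seq u j * g j)| <= M * stick_rem_seq u m.
  rewrite ler_distl; apply/andP; split.
    apply: limr_ge => //; near=> n.
    by have := tail n; rewrite ler_distl => /(_ _)/andP[]//; near: n; exact: nbhs_infty_ge.
  apply: limr_le => //; near=> n.
  by have := tail n; rewrite ler_distl => /(_ _)/andP[]//; near: n; exact: nbhs_infty_ge.
set L := limn _ in hl *; set W := limn _.
have W1 : W <= 1.
  apply: limr_le => //; apply: nearW => n; rewrite sumE gerBl; by case/andP: (r01 n).
have Wm : 1 - stick_rem_seq u m <= W.
  apply: limr_ge => //; near=> n; rewrite -sumE; apply: mono; near: n; exact: nbhs_infty_ge.
rewrite addrAC; apply: le_trans (ler_normD _ _) _.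
rewrite -mulrA mulr_natl mulr2n lerD// normrM mulrC.
apply: ler_pM => //; rewrite ger0_norm ?subr_ge0//; lra.
Unshelve. all: end_near. Qed.

End StickWeights.

(** * The Markov chain of the sticks *)

Section Process.
Context {R : realType} {d : measure_display} {Omega : measurableType d}.
Variables (N : nat) (al be : nat -> R) (Pr : probability Omega R) (v : nat -> Omega -> R).
Hypotheses (hal : forall j, 0 < al j) (hbe : forall j, 0 < be j).
Hypothesis mv : forall j, measurable_fun setT (v j).
Hypothesis hv0 : forall B, measurable B -> Pr (v 0%N @^-1` B) = betaL (al 0%N) (be 0%N) B.
Hypothesis hvS : forall (j : nat) (A : nat -> set R) (B : set R),
  (forall i, measurable (A i)) -> measurable B ->
  Pr ([set w | forall i, (i <= j)%N -> A i (v i w)] `&` (v j.+1 @^-1` B))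
  = (\int[Pr]_(w in [set w | forall i, (i <= j)%N -> A i (v i w)])
       bmsb_kernel N al be j (v j w) B)%E.

Implicit Types B : set R.

Definition rect (A : nat -> set R) (k : nat) : set Omega :=
  [set w | forall i, (i < k)%N -> A i (v i w)].

Lemma rectS A k : rect A k.+1 = rect A k `&` v k @^-1` (A k).
Proof.
apply/seteqP; split => w /=.
  by move=> h; split => [i ik|]; apply: h => //; rewrite ltnS ltnW.
by move=> [h1 h2] i; rewrite ltnS leq_eqVlt => /orP[/eqP->//|]; exact: h1.
Qed.

Lemma rect0 A : rect A 0 = setT.
Proof. by apply/seteqP; split. Qed.

Lemma measurable_preim j B : measurable B -> measurable (v j @^-1` B).
Proof. by move=> mB; rewrite -[X in measurable X]setTI; exact: mv. Qed.

Lemma measurable_rect A k : (forall i, measurable (A i)) -> measurable (rect A k).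
Proof.
move=> mA; elim: k => [|k IH]; first by rewrite rect0.
by rewrite rectS; apply: measurableI => //; exact: measurable_preim.
Qed.

Lemma rect_step A j B : (forall i, measurable (A i)) -> measurable B ->
  Pr (rect A j.+1 `&` v j.+1 @^-1` B) =
  (\int[Pr]_(w in rect A j.+1) (kern N al be j (v j w) B)%:E)%E.
Proof.
move=> mA mB; rewrite (hvS j mA mB); apply: eq_integral => w _.
by rewrite bmsb_kernelE.
Qed.

Lemma measurable_kern_v j B D : measurable D ->
  measurable_fun D (fun w => (kern N al be j (v j w) B)%:E).
Proof.
move=> mD; apply/measurable_EFinP.
apply: (@measurable_funS _ _ _ _ setT) => //.
exact: (measurableT_comp (measurable_kern N hal hbe j B) (mv j)).
Qed.

(** The initial law and every mixture component of the kernel live on the open unit interval. *)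
Lemma preim_null j B : measurable B -> B `&` `]0, 1[ = set0 -> Pr (v j @^-1` B) = 0%E.
Proof.
move=> mB h; case: j => [|j].
  by rewrite hv0// beta_pr_fin// beta_pr_disj01.
have mT : forall i : nat, measurable (setT : set R) by [].
have := @rect_step (fun=> setT) j B mT mB.
have -> : rect (fun=> setT) j.+1 = setT by apply/seteqP; split.
rewrite setTI => ->; apply: integral0_eq => w _.
by rewrite kern_disj01.
Qed.

Definition in01 : set Omega := [set w | forall j, 0 < v j w < 1].

Lemma measurable_in01 : measurable in01.
Proof.
have -> : in01 = \bigcap_j (v j @^-1` `]0, 1[%classic).
  apply/seteqP; split => [w h j _|w h j]; first by rewrite /= in_itv/= h.
  by have := h j I; rewrite /= in_itv.
apply: bigcapT_measurable => j; exact: measurable_preim.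
Qed.

Lemma ae_in01 : {ae Pr, forall w, in01 w}.
Proof.
apply: ae_foralln => j.
exists (v j @^-1` (~` `]0, 1[%classic)); split.
- by apply: measurable_preim; exact: measurableC.
- by apply: preim_null; [exact: measurableC|rewrite setICl].
- by move=> w /= h; rewrite in_itv.
Qed.

Lemma Pr_in01 : Pr in01 = 1%E.
Proof.
have [A [mA A0 sA]] := ae_in01.
have h : Pr (~` in01) = 0%E.
  apply: (subset_measure0 _ mA sA A0).
  by apply: measurableC; exact: measurable_in01.
by have := probability_setC Pr (measurableC measurable_in01); rewrite setCK h sube0.
Qed.

(** Whatever the past, the next stick hits its interval with probability at least a constant
    [c > 0], so each step multiplies the probability by at least [c]. *)
Lemma rect_gt0 (s t : nat -> R) k :
  (forall i, 0 <= s i) -> (forall i, s i < t i) -> (forall i, t i <= 1) ->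
  (0 < Pr (rect (fun i => `]s i, t i[%classic) k))%E.
Proof.
move=> s0 st t1; elim: k => [|k IH]; first by rewrite rect0 probability_setT lte01.
have mA i : measurable (`]s i, t i[%classic : set R) by exact: measurable_itv.
rewrite rectS; case: k IH => [_|k IH].
  rewrite rect0 setTI hv0// beta_pr_fin// lte_fin; exact: beta_pr_itv_gt0.
rewrite rect_step//.
have [c c0 hc] := kern_itv_gt0 N hal hbe k (s0 k.+1) (st k.+1) (t1 k.+1).
set E := rect _ _.
have mE : measurable E by exact: measurable_rect.
apply: (@lt_le_trans _ _ (\int[Pr]_(w in E) c%:E)%E).
  by rewrite integral_cst// mule_gt0// lte_fin.
apply: ge0_le_integral => //.
- by move=> w _; rewrite lee_fin ltW.
- exact: measurable_kern_v.
- by move=> w _; rewrite lee_fin.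
Qed.

(** It agrees with [1 - x] on [0, 1], where the sticks almost surely lie, and is nonnegative and
    bounded by layer counts everywhere, so integrals need no exceptional set. *)
Definition clip (x : R) : R := if 0 <= x <= 1 then 1 - x else 0.

Lemma clip_ge0 x : 0 <= clip x.
Proof. by rewrite /clip; case: ifP => // /andP[_]; rewrite subr_ge0. Qed.

Lemma clip_layer n x : (0 < n)%N -> clip x <= n%:R^-1 * \sum_(l < n) (\1_(layer n l) x : R).
Proof.
move=> n0; rewrite /clip; case: ifP => [h|_].
  have /andP[h1 _] := layer_sum_bounds n0 h.
  by rewrite mulrC ler_pdivlMr ?ltr0n// mulrC.
by rewrite mulr_ge0 ?invr_ge0 ?ler0n// sumr_ge0// => l _; rewrite indicE ler0n.
Qed.

Lemma measurable_clip : measurable_fun setT clip.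
Proof.
apply: measurable_fun_ifT => //; last exact: measurable_funB.
by apply: measurable_and; apply: measurable_fun_ler.
Qed.

(** The starting time [k] is a parameter because the induction removes the earliest factor. *)
Definition tailprod (k m : nat) (w : Omega) : R := \prod_(i < m) clip (v (k + i)%N w).

Lemma tailprod_ge0 k m w : 0 <= tailprod k m w.
Proof. by apply: prodr_ge0 => i _; exact: clip_ge0. Qed.

Lemma tailprodS k m w : tailprod k m.+1 w = clip (v k w) * tailprod k.+1 m w.
Proof.
rewrite /tailprod big_ord_recl addn0; congr (_ * _).
by apply: eq_bigr => i _; rewrite /bump/= addSnnS.
Qed.

Lemma measurable_tailprod k m D : measurable D ->
  measurable_fun D (fun w => (tailprod k m w)%:E).
Proof.
move=> mD; apply/measurable_EFinP; apply: measurable_prod => i _.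
apply: (@measurable_funS _ _ _ _ setT) => //.
exact: (measurableT_comp measurable_clip (mv _)).
Qed.

(** For [j >= 1] this is the mean of the mixture component [z = 0], the smallest among all
    components, hence a lower bound for the conditional mean of [v j]. *)
Definition drift (j : nat) : R := al j / (al j + be j + N%:R).

Lemma drift01 j : 0 < drift j <= 1.
Proof.
have d0 : 0 < al j + be j + N%:R by rewrite ltr_pwDl// addr_gt0.
rewrite divr_gt0//= ler_pdivrMr// mul1r -addrA lerDl addr_ge0//.
exact: ltW.
Qed.

(* The layers replace 1 - v_k by a sum of indicators, so that only rectangles in
   (v_0, ..., v_k) are needed. *)
Lemma integral_tailprod_le m : forall j A, (forall i, measurable (A i)) ->
  (\int[Pr]_(w in rect A j.+1) (tailprod j.+1 m w)%:E <=
   Pr (rect A j.+1) * (\prod_(i < m) (1 - drift (j.+1 + i) / 2))%:E)%E.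
Proof.
elim: m => [|m IH] j A mA.
  have mE := measurable_rect j.+1 mA.
  rewrite /tailprod; under eq_integral do rewrite big_ord0.
  by rewrite big_ord0 integral_cst// mul1e mule1.
set k := j.+1.
have mE : measurable (rect A k) by exact: measurable_rect.
have /andP[dk0 dk1] := drift01 k.
(* With [1 / n <= drift k / 2] the rounding error of the layers costs at most half of the drift;
   this is where the factor [1 - drift / 2] comes from. *)
pose n := (Num.truncn (drift k / 2)^-1).+1.
have n0 : (0 < n)%N by [].
have dk2 : 0 < drift k / 2 by exact: divr_gt0.
have nV : n%:R^-1 <= drift k / 2.
  rewrite -[leRHS]invrK lef_pV2 ?posrE ?invr_gt0 ?ltr0n//.
  by apply: ltW; exact: truncnS_gt.
(* Adding the constraint that [v k] lies in a layer gives a rectangle one step longer, to which the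
   induction hypothesis applies. *)
pose A' l i := if i == k then layer n l else A i.
have mA' l i : measurable (A' l i).
  by rewrite /A'; case: ifP => // _; exact: measurable_layer.
have rA' l : rect (A' l) k = rect A k.
  apply/seteqP; split => w h i ik; have := h i ik; rewrite /A' ifN//; by rewrite ltn_eqF.
have rA'S l : rect (A' l) k.+1 = rect A k `&` v k @^-1` layer n l.
  by rewrite rectS rA' {1}/A' eqxx.
pose C : R := \prod_(i < m) (1 - drift (k.+1 + i) / 2).
have C0 : 0 <= C.
  apply: prodr_ge0 => i _; have /andP[_ h] := drift01 (k.+1 + i).
  by rewrite subr_ge0 ler_pdivrMr// (le_trans h)// mul1r ler1n.
pose f l := (fun w => (tailprod k.+1 m w)%:E) \_ (v k @^-1` layer n l).
(* The earliest factor is dominated by the average of the layer indicators. *)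
have h1 : (\int[Pr]_(w in rect A k) (tailprod k m.+1 w)%:E <=
    \int[Pr]_(w in rect A k) (\sum_(l < n) (n%:R^-1)%:E * f l w))%E.
  apply: ge0_le_integral => //.
  - by move=> w _; rewrite lee_fin tailprod_ge0.
  - exact: measurable_tailprod.
  - apply: emeasurable_sum => l; apply: measurable_funeM.
    apply/measurable_restrict => //; first by apply: measurable_preim; exact: measurable_layer.
    by apply: measurable_tailprod; apply: measurableI => //;
      apply: measurable_preim; exact: measurable_layer.
  - move=> w _; rewrite tailprodS.
    apply: (@le_trans _ _ ((n%:R^-1 * \sum_(l < n) (\1_(layer n l) (v k w) : R)) * tailprod k.+1 m w)%:E).
      by rewrite lee_fin ler_wpM2r ?tailprod_ge0 ?clip_layer.
    rewrite mulr_sumr mulr_suml -sumEFin lee_sum// => l _.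
    rewrite /f patchE indicE.
    have -> : (w \in v k @^-1` layer n l) = (v k w \in layer n l).
      by apply/idP/idP; rewrite !inE.
    by case: ifP => _; rewrite ?mulr1 ?mulr0 ?mul0r ?mule0// -EFinM.
apply: (le_trans h1).
rewrite ge0_integral_sum//; last 2 first.
- move=> l; apply: measurable_funeM.
  apply/measurable_restrict => //; first by apply: measurable_preim; exact: measurable_layer.
  by apply: measurable_tailprod; apply: measurableI => //;
      apply: measurable_preim; exact: measurable_layer.
- move=> l w _; rewrite mule_ge0 ?lee_fin ?invr_ge0//.
  by apply: erestrict_ge0 => y _; rewrite lee_fin tailprod_ge0.
(* For each layer, the induction hypothesis bounds the later factors by [C], and the Markov property
   expresses the probability of the longer rectangle by the kernel. *)
apply: (@le_trans _ _ (\sum_(l < n) (n%:R^-1)%:E *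
   ((\int[Pr]_(w in rect A k) (kern N al be j (v j w) (layer n l))%:E) * C%:E))%E).
  apply: lee_sum => l _.
  rewrite ge0_integralZl_EFin ?invr_ge0//; last 2 first.
  - by move=> w _; apply: erestrict_ge0 => y _; rewrite lee_fin tailprod_ge0.
  - apply/measurable_restrict => //; first by apply: measurable_preim; exact: measurable_layer.
    by apply: measurable_tailprod; apply: measurableI => //;
      apply: measurable_preim; exact: measurable_layer.
  rewrite -integral_mkcondr -rA'S -rect_step//; last exact: measurable_layer.
  rewrite -rA'S lee_wpmul2l ?lee_fin ?invr_ge0//.
  exact: IH.
rewrite -ge0_sume_distrr; last first.
  move=> l _; rewrite mule_ge0 ?lee_fin// integral_ge0// => w _.
  by rewrite lee_fin kern_ge0//; exact: measurable_layer.
rewrite -ge0_sume_distrl; last first.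
  move=> l _; rewrite integral_ge0// => w _.
  by rewrite lee_fin kern_ge0//; exact: measurable_layer.
rewrite -ge0_integral_sum//; last 2 first.
- by move=> l; exact: measurable_kern_v.
- by move=> l w _; rewrite lee_fin kern_ge0//; exact: measurable_layer.
(* Summed over the layers, the kernel is bounded independently of the state. *)
apply: (@le_trans _ _ ((n%:R^-1)%:E *
   ((\int[Pr]_(w in rect A k) (n%:R * (1 - drift k) + 1)%:E) * C%:E))%E).
  rewrite lee_wpmul2l ?lee_fin ?invr_ge0// lee_wpmul2r ?lee_fin//.
  apply: ge0_le_integral => //.
  - move=> w _; apply: sume_ge0 => l _.
    by rewrite lee_fin kern_ge0//; exact: measurable_layer.
  - by apply: emeasurable_sum => l; exact: measurable_kern_v.
  - by move=> w _; rewrite sumEFin lee_fin; exact: kern_layer_sum.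
rewrite integral_cst// muleAC muleA muleC lee_wpmul2l//.
rewrite -!EFinM lee_fin big_ord_recl addn0.
under [X in _ <= _ * X]eq_bigr do rewrite /bump/= addnA addn1.
rewrite mulrA ler_wpM2r//.
rewrite mulrDr mulrA mulVf ?mul1r ?mulr1 ?pnatr_eq0//.
lra.
Qed.

Definition stick_rem j w : R := stick_rem_seq (v ^~ w) j.

Lemma stick_w_gt0 j w : in01 w -> 0 < stick_w v j w.
Proof.
move=> h; have /andP[vj _] := h j; rewrite mulr_gt0// prodr_gt0// => i _.
by have /andP[_ vi] := h i; rewrite subr_gt0.
Qed.

Lemma sum_stick_w n w : \sum_(j < n) stick_w v j w = 1 - stick_rem n w.
Proof. exact: sum_stick_seq. Qed.

Lemma stick_rem_ge0 n w : in01 w -> 0 <= stick_rem n w.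
Proof.
by move=> h; apply: prodr_ge0 => i _; have /andP[_ /ltW] := h i; rewrite subr_ge0.
Qed.

Lemma stick_rem_le n m w : in01 w -> (n <= m)%N -> stick_rem m w <= stick_rem n w.
Proof.
move=> h /subnKC <-; elim: (m - n)%N => [|k IH]; first by rewrite addn0.
rewrite addnS (le_trans _ IH)// /stick_rem /stick_rem_seq big_ord_recr/= ler_piMr//.
  exact: stick_rem_ge0.
by have /andP[/ltW h0 _] := h (n + k)%N; rewrite gerBl.
Qed.

(** The first factor, at most 1, is dropped: [v 0] is not drawn from the kernel, so the products
    start at time 1. *)
Lemma stick_rem_le_tailprod n w : in01 w -> stick_rem n.+1 w <= tailprod 1 n w.
Proof.
move=> h; rewrite /stick_rem /stick_rem_seq big_ord_recl/= /tailprod.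
have -> : \prod_(i < n) (1 - v (bump 0 i) w) = \prod_(i < n) clip (v (1 + i)%N w).
  apply: eq_bigr => i _; rewrite /clip /bump/=.
  by have /andP[/ltW-> /ltW->] := h (1 + i)%N.
rewrite ler_piMl//; first by apply: tailprod_ge0.
by have /andP[/ltW h0 _] := h 0%N; rewrite gerBl.
Qed.

(** An elementary substitute for the exponential bound; the induction step is
    [(1 - x) (1 + S + x) <= 1 + S]. *)
Lemma prod_one_sub_le (x : nat -> R) n : (forall i, 0 <= x i <= 1) ->
  \prod_(i < n) (1 - x i) <= (1 + \sum_(i < n) x i)^-1.
Proof.
move=> h; have S0 m : 0 <= \sum_(i < m) x i.
  by apply: sumr_ge0 => i _; case/andP: (h i).
elim: n => [|n IH]; first by rewrite !big_ord0 addr0 invr1.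
rewrite !big_ord_recr/=; set P := \prod_(i < n) _ in IH *; set S := \sum_(i < n) _ in IH *.
have /andP[x0 x1] := h n.
have Sn : 0 <= S := S0 n.
have p0 : 0 < 1 + S by lra.
have p1 : 0 < 1 + (S + x n) by lra.
apply: (le_trans (ler_wpM2r _ IH)); first by rewrite subr_ge0.
rewrite -[leRHS]mul1r ler_pdivlMr// -mulrA ler_pdivrMl// mulr1.
by have := mulr_ge0 Sn x0; have := mulr_ge0 x0 x0; rewrite mulrDr; nra.
Qed.

Definition tailprod_ge (e : R) : set Omega := [set w | forall i, e <= tailprod 1 i w].

Lemma measurable_tailprod_ge e : measurable (tailprod_ge e).
Proof.
  have -> : tailprod_ge e = \bigcap_i (tailprod 1 i @^-1` `[e, +oo[%classic).
    apply/seteqP; split => [w h i _|w h i]; first by rewrite /= in_itv/= andbT h.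
    by have := h i I; rewrite /= in_itv/= andbT.
  apply: bigcapT_measurable => i.
  rewrite -[X in measurable X]setTI.
  have := @measurable_tailprod 1 i setT measurableT.
  by move/measurable_EFinP; apply.
Qed.

(** Markov's inequality for [tailprod 1 m], whose mean [integral_tailprod_le] bounds. *)
Lemma Pr_tailprod_ge e m : 0 < e ->
  (e%:E * Pr (tailprod_ge e) <= ((1 + \sum_(i < m) drift i.+1 / 2)^-1)%:E)%E.
Proof.
move=> e0; set E := tailprod_ge e.
have mE : measurable E by exact: measurable_tailprod_ge.
apply: (@le_trans _ _ (\int[Pr]_(w in setT) (tailprod 1 m w)%:E)%E).
  rewrite -integral_cst//.
  apply: (@le_trans _ _ (\int[Pr]_(w in E) (tailprod 1 m w)%:E)%E).
    apply: ge0_le_integral => //.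
    - by move=> w _; rewrite lee_fin ltW.
    - exact: measurable_tailprod.
    - by move=> w h; rewrite lee_fin; exact: h.
  apply: ge0_subset_integral => //.
  - exact: measurable_tailprod.
  - by move=> w _; rewrite lee_fin tailprod_ge0.
have := @integral_tailprod_le m 0 (fun=> setT) (fun=> measurableT).
have -> : rect (fun=> setT) 1 = setT by apply/seteqP; split.
move/le_trans; apply; rewrite probability_setT mul1e lee_fin.
apply: (prod_one_sub_le (x := fun i => drift i.+1 / 2)) => i.
have /andP[h0 h1] := drift01 i.+1.
by rewrite divr_ge0 ?(ltW h0)//= ler_pdivrMr// mul1r (le_trans h1)// ler1n.
Qed.

Lemma ae_stick_rem_cvg0 : (forall K, exists m, K <= \sum_(i < m) drift i.+1) ->
  {ae Pr, forall w, stick_rem n w @[n --> \oo] --> (0 : R)}.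
Proof.
move=> hdiv.
have null e : 0 < e -> Pr (tailprod_ge e) = 0%E.
  move=> e0; apply/eqP; rewrite eq_le measure_ge0 andbT leNgt; apply/negP => p0.
  have fP : Pr (tailprod_ge e) \is a fin_num.
    by apply: fin_num_measure; exact: measurable_tailprod_ge.
  move: p0; rewrite -(fineK fP) lte_fin; set p := fine _ => p0.
  have ep : 0 < e * p by rewrite mulr_gt0.
  (* Half of this drift sum is at least [1 / (e p)], so the bound [1 / (1 + S / 2)] falls strictly
     below [e p]. *)
  have [m hm] := hdiv (2 / (e * p)).
  have := Pr_tailprod_ge m e0; rewrite -(fineK fP) -/p -EFinM lee_fin -mulr_suml.
  move: hm; set S := \sum_(i < m) _ => hm.
  have hS : (e * p)^-1 <= S / 2 by rewrite ler_pdivlMr// mulrC.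
  have S0 : 0 < S / 2 by rewrite (lt_le_trans _ hS)// invr_gt0.
  rewrite leNgt => /negP; apply.
  rewrite -[ltRHS]invrK ltf_pV2 ?posrE ?invr_gt0//; first by lra.
  by rewrite addr_gt0.
(* Discard the countably many null events for [e = 1 / (p + 1)]; elsewhere some product falls below
   each threshold, and the nonincreasing remainder stays below it. *)
have : {ae Pr, forall w, forall p : nat, ~ tailprod_ge p.+1%:R^-1 w}.
  apply: ae_foralln => p; exists (tailprod_ge p.+1%:R^-1); split.
  - exact: measurable_tailprod_ge.
  - by apply: null; rewrite invr_gt0.
  - by move=> w /= /contrapT.
apply: filterS2 ae_in01 => w h01 hw.
apply/cvgr0Pnorm_lt => e e0.
have := hw (Num.truncn e^-1) => /existsNP[i /negP]; rewrite -ltNge => hi.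
exists i.+1 => // n /= hn.
rewrite ger0_norm ?stick_rem_ge0//.
apply: (le_lt_trans (stick_rem_le h01 hn)).
apply: (le_lt_trans (stick_rem_le_tailprod _ h01)).
apply: (lt_le_trans hi); rewrite -[leRHS]invrK lef_pV2 ?posrE ?invr_gt0//.
by apply: ltW; exact: truncnS_gt.
Qed.

(** If [M] bounds all [(al j + be j)^-1], then [al j + be j + N <= (1 + N M) (al j + be j)], so the
    drifts are comparable with the terms of the divergent series. *)
Lemma drift_diverges :
  (fun n => \sum_(j < n) (al j / (al j + be j))) @ \oo --> +oo ->
  (limn_esup (fun j => ((al j + be j)^-1)%:E) < +oo)%E ->
  forall K, exists m, K <= \sum_(i < m) drift i.+1.
Proof.
move=> hs hlim.
(* The finite upper limit bounds all but the first [n0] terms; the sum of these is added to cover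
   them too. *)
have [M hM] : exists M, forall j, (al j + be j)^-1 <= M.
  move: hlim; rewrite /limn_esup/= /limf_esup => /ereal_inf_lt[y [V [n0 _ hV] <-]] hy.
  set u := fun j => _ in hy; set y' := ereal_sup _ in hy.
  have hu j : (n0 <= j)%N -> (u j <= y')%E.
    by move=> hj; apply: ereal_sup_ubound; exists j => //; exact: hV.
  have y'fin : y' \is a fin_num.
    rewrite fin_numE; apply/andP; split; last by rewrite lt_eqF.
    have := hu n0 (leqnn n0); rewrite /u; case: (y') => //.
  exists (fine y' + \sum_(i < n0) (al i + be i)^-1) => j.
  have inv0 i : 0 <= (al i + be i)^-1 by rewrite invr_ge0 addr_ge0// ltW.
  have S0 : 0 <= \sum_(i < n0) (al i + be i)^-1 by rewrite sumr_ge0.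
  have y0 : 0 <= fine y'.
    rewrite -lee_fin fineK//; apply: le_trans (hu n0 (leqnn n0)).
    by rewrite lee_fin.
  have [jn|jn] := leqP n0 j.
    rewrite -[leLHS]addr0 lerD// -lee_fin fineK//; exact: hu.
  rewrite (bigD1 (Ordinal jn))//= addrCA lerDl addr_ge0//.
  by rewrite sumr_ge0.
pose D := 1 + N%:R * M.
have M0 : 0 < M by rewrite (lt_le_trans _ (hM 0%N))// invr_gt0 addr_gt0.
have D0 : 0 < D by rewrite ltr_pwDl// mulr_ge0// ltW.
have hd j : al j / (al j + be j) <= D * drift j.
  have s0 : 0 < al j + be j by exact: addr_gt0.
  have h := hM j; rewrite /drift.
  set t := al j + be j in s0 h *.
  have t0 : 0 < t + N%:R by rewrite ltr_pwDl.
  rewrite ler_pdivrMr// (_ : _ * t = al j * (D * t / (t + N%:R))); last by ring.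
  rewrite ler_pMr// ler_pdivlMr// mul1r /D mulrDl mul1r lerD2l -mulrA.
  by rewrite -[leLHS]mulr1 ler_wpM2l// -ler_pdivrMr// mul1r.
(* The surplus 1 in [K + 1] pays for omitting [drift 0 <= 1]. *)
move=> K; move/cvgryPge : hs => /(_ (D * (K + 1))) [n _ hn].
exists n; have := hn n (leqnn n) => h.
have h2 : D * (K + 1) <= D * \sum_(j < n.+1) drift j.
  rewrite (le_trans h)// big_ord_recr/= mulrDr mulr_sumr -[leLHS]addr0.
  by rewrite lerD// ?ler_sum// mulr_ge0 ?ltW//; have /andP[] := drift01 n.
move: h2; rewrite ler_pM2l// big_ord_recl/= => h2.
have /andP[_ d1] := drift01 0.
by move: h2; set S := \sum_(i < n) _; rewrite (_ : S = \sum_(i < n) drift i.+1)//; lra.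
Qed.

End Process.

(** * Finite approximation of a measure on its support *)

Section BorelMeasures.
Context {R : realType}.

Lemma open_borel_measurable {T : ptopologicalType} (U : set T) :
  open U -> measurable (U : set (borel T)).
Proof. by move=> oU; exact: sub_sigma_algebra. Qed.

Lemma continuous_borel_measurable {T : ptopologicalType} (f : T -> R) :
  continuous f -> measurable_fun setT (f : borel T -> R).
Proof.
move=> cf; apply: (measurability _ (RGenOInfty.measurableE R)).
move=> _ [_ [r ->] <-]; rewrite setTI; apply: open_borel_measurable.
by move/continuousP : cf; apply; exact: interval_open.
Qed.

Lemma open_msupportC {T : ptopologicalType} (Q : set (borel T) -> \bar R) :
  open (~` msupport Q).
Proof.
rewrite openE => x; rewrite /= => /existsNP[U] /not_implyP[oU] /not_implyP[Ux QU].
rewrite /interior/= nbhsE; exists U; first by split.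
by move=> y Uy /(_ U oU Uy); exact: QU.
Qed.

(** By separability, countably many balls of null measure, with centres in a dense set and radii
    [1 / (n + 1)], cover the complement of the support. *)
Lemma msupportC0 {T : completePseudoMetricType R} (sepT : separable_space T)
  (Q : probability (borel T) R) : Q (~` msupport Q) = 0%E.
Proof.
have [D [cD dD]] := sepT.
have [D0|[e]] := pfcard_geP cD.
  by have := dD; rewrite D0 closure0 => h; have : (@setT T) point by []; rewrite -h.
pose U (d : T) (n : nat) : set (borel T) := (ball d n.+1%:R^-1)°.
have mU d n : measurable (U d n).
  by apply: open_borel_measurable; exact: open_interior.
pose F (i n : nat) := if `[< Q (U (e i) n) = 0%E >] then U (e i) n else set0.
have nF i n : Q.-negligible (F i n).
  rewrite /F; case: asboolP => [h|_]; last exact: negligible_set0.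
  by exists (U (e i) n); split => //; exact: mU.
have nB : Q.-negligible (\bigcup_i \bigcup_n F i n).
  by apply: negligible_bigcup => i; exact: negligible_bigcup.
have [A [mA A0 sA]] := nB.
apply: (subset_measure0 _ mA _ A0).
  by apply: open_borel_measurable; exact: open_msupportC.
apply: subset_trans sA => x /existsNP[V] /not_implyP[oV] /not_implyP[Vx QV].
have QV0 : Q V = 0%E.
  by apply/eqP; rewrite eq_le measure_ge0 andbT leNgt; exact/negP.
have : nbhs x V by exact: open_nbhs_nbhs.
rewrite -nbhs_ballE => -[r /= r0 rV].
(* Twice the radius [1 / (n + 1)] is at most [r]. A centre within half that radius of [x] then gives
   a ball that has [x] in its interior and stays inside [V]. *)
pose n := Num.truncn (2 / r).
have n0 : 0 < n.+1%:R^-1 :> R by rewrite invr_gt0.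
have nr : n.+1%:R^-1 + n.+1%:R^-1 <= r.
  have h : n.+1%:R^-1 <= r / 2.
    rewrite -[leRHS]invrK lef_pV2 ?posrE ?invr_gt0 ?divr_gt0// invf_div.
    by apply: ltW; exact: truncnS_gt.
  by rewrite [leRHS]splitr lerD.
have clx : closure D x by rewrite dD.
pose h : R := n.+1%:R^-1 / 2.
have h0 : 0 < h by rewrite divr_gt0.
have [y [Dy xy]] : D `&` ball x h !=set0 by apply: clx; exact: nbhsx_ballx.
have [i _ eiy] := @surj _ _ _ _ e y Dy.
exists i => //; exists n => //; rewrite /F eiy.
have UV : U y n `<=` V.
  move=> z /interior_subset yz; apply: rV; apply: (le_ball nr).
  apply: ball_triangle yz; apply: le_ball xy.
  by rewrite ler_pdivrMr// ler_peMr ?ltW// ltr1n.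
have QU : Q (U y n) = 0%E.
  by apply: (subset_measure0 _ _ UV QV0) => //; exact: open_borel_measurable.
rewrite asboolT//; rewrite /U /interior/=.
apply: (@filterS _ _ _ (ball x h)); last exact: nbhsx_ballx.
move=> z xz; rewrite (splitr n.+1%:R^-1); apply: ball_triangle xz.
exact: ball_sym.
Qed.

(** * Quantisation of the test functions *)

Section Grid.
Context {T : ptopologicalType} (Q : probability (borel T) R).
Hypothesis suppQ : Q (~` msupport Q) = 0%E.

Lemma msupport_nonempty : msupport Q !=set0.
Proof.
apply/set0P/eqP => h; move: suppQ; rewrite h setC0 probability_setT => /eqP.
by rewrite onee_eq0.
Qed.

Lemma bounded_integrable (P : probability (borel T) R) (f : T -> R) M D :
  continuous f -> (forall x, `|f x| <= M) -> measurable (D : set (borel T)) ->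
  P.-integrable D (EFin \o (f : borel T -> R)).
Proof.
move=> cf bf mD; apply: measurable_bounded_integrable => //.
- by rewrite (le_lt_trans (probability_le1 _ mD))// ltry.
- apply: (@measurable_funS _ _ _ _ setT) => //; exact: continuous_borel_measurable.
- exists M; split; first by rewrite num_real.
  by move=> M' MM' x _ /=; rewrite (le_trans (bf x))// ltW.
Qed.

Lemma Rintegral_bounds (P : probability (borel T) R) (f : T -> R) M D a b :
  continuous f -> (forall x, `|f x| <= M) -> measurable (D : set (borel T)) ->
  (forall x, D x -> a <= f x <= b) ->
  a * fine (P D) <= \int[P]_(x in D) (f : borel T -> R) x <= b * fine (P D).
Proof.
move=> cf bf mD h; rewrite -!Rintegral_cst//.
have int0 c : P.-integrable D (EFin \o cst c).
  by apply: (@bounded_integrable P (cst c) `|c|) => //; exact: cst_continuous.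
have intf := bounded_integrable P cf bf mD.
apply/andP; split; apply: le_Rintegral => //; try exact: int0.
- by move=> x /h /andP[].
- by move=> x /h /andP[].
Qed.

Variables (k : nat) (f : 'I_k -> T -> R) (M eps : R).
Hypotheses (eps0 : 0 < eps) (cf : forall i, continuous (f i)).
Hypothesis (bf : forall i x, `|f i x| <= M).

(** The values [f i x + M] lie in [0, 2M] and are cut into steps of length [eps], so [n] is the
    largest label needed; on a cell no test function varies by more than [eps]. *)
Let n := Num.truncn ((M + M) / eps).
Let lab (x : T) : {ffun 'I_k -> 'I_n.+1} :=
  [ffun i => inord (Num.truncn ((f i x + M) / eps))].
Let cell (a : {ffun 'I_k -> 'I_n.+1}) : set (borel T) := lab @^-1` [set a].

Lemma labP i x (j : 'I_n.+1) :
  (lab x i == j) = (j%:R * eps <= f i x + M < j.+1%:R * eps).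
Proof.
have := bf i x; rewrite ler_norml => /andP[b1 b2].
have g0 : 0 <= (f i x + M) / eps by rewrite divr_ge0 ?(ltW eps0)//; lra.
rewrite ffunE -val_eqE/= inordK; last first.
  rewrite ltnS; apply: le_truncn; rewrite ler_pM2r ?invr_gt0//; lra.
by rewrite truncn_eq// ler_pdivlMr// ltr_pdivrMr.
Qed.

Lemma measurable_cell a : measurable (cell a).
Proof.
have -> : cell a = \bigcap_(i in [set: 'I_k])
    ((f i : borel T -> R) @^-1` `[(a i)%:R * eps - M, (a i).+1%:R * eps - M[%classic).
  apply/seteqP; split => [x /= ax i _|x h].
    by rewrite /= in_itv/= lerBlDr ltrBrDr -labP ax.
  apply/ffunP => i; apply/eqP; rewrite labP.
  by have := h i I; rewrite /= in_itv/= lerBlDr ltrBrDr.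
apply: fin_bigcap_measurable => // i _.
rewrite -[X in measurable X]setTI; exact: continuous_borel_measurable.
Qed.

Lemma cell_osc a i x y : cell a x -> cell a y -> `|f i x - f i y| <= eps.
Proof.
move=> ax ay.
have /andP[x1 x2] : (a i)%:R * eps <= f i x + M < (a i).+1%:R * eps by rewrite -labP ax.
have /andP[y1 y2] : (a i)%:R * eps <= f i y + M < (a i).+1%:R * eps by rewrite -labP ay.
move: x2 y2; rewrite -natr1 mulrDl mul1r => x2 y2.
by rewrite ler_norml; apply/andP; split; lra.
Qed.

(** Put the mass [Q (cell a)] at one point of the support, chosen in the cell whenever the cell
    meets the support. The error on each cell is at most [eps] times its mass, and the masses add up
    to 1. *)
Lemma finite_approx : exists m (q : nat -> R) (x : nat -> T),
  [/\ forall l, 0 <= q l, forall l, (m <= l)%N -> q l = 0, \sum_(l < m) q l = 1, forall l, msupport Q (x l) &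
      forall i, `|\sum_(l < m) q l * f i (x l) - fine (\int[Q]_x (f i x)%:E)%E| <= eps].
Proof.
pose I := {ffun 'I_k -> 'I_n.+1}.
have [x0 sx0] := msupport_nonempty.
have ex a : exists x, msupport Q x /\ ((cell a `&` msupport Q !=set0) -> cell a x).
  have [[x [ax sx]]|h] := pselect (cell a `&` msupport Q !=set0).
    by exists x.
  by exists x0; split.
have [y hy] := choice ex.
have triv : trivIset [set` index_enum I] cell by exact: trivIset_preimage1.
have cov : \big[setU/set0]_(a <- index_enum I) cell a = setT.
  apply/seteqP; split => // x _; rewrite -bigcup_seq; exists (lab x) => //=.
  exact: mem_index_enum.
have sumg (g : T -> R) (M' : R) : continuous g -> (forall x, `|g x| <= M') ->
    fine (\int[Q]_x (g x)%:E)%E = \sum_a \int[Q]_(x in cell a) (g : borel T -> R) x.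
  move=> cg bg; rewrite -cov integral_bigsetU_EFin//.
  - rewrite (eq_bigr (fun a => (\int[Q]_(x in cell a) (g : borel T -> R) x)%:E)).
      by rewrite sumEFin.
    move=> a _; rewrite /Rintegral fineK//; apply: integrable_fin_num.
      exact: measurable_cell.
    exact: (bounded_integrable Q cg bg (measurable_cell a)).
  - by move=> a; exact: measurable_cell.
  - exact: index_enum_uniq.
  - rewrite cov; apply/measurable_EFinP; exact: continuous_borel_measurable.
have sumQ : \sum_a fine (Q (cell a)) = 1.
  have c1 : continuous (cst 1 : T -> R) by move=> ?; exact: cst_continuous.
  have b1 (x : T) : `|cst 1 x : R| <= 1 by rewrite normr1.
  have := sumg _ _ c1 b1.
  rewrite -/(Rintegral Q setT (cst 1)) Rintegral_cst// mul1r.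
  have -> : fine (Q setT) = 1 by rewrite probability_setT.
  move=> ->.
  by apply: eq_bigr => a _; rewrite Rintegral_cst ?mul1r//; exact: measurable_cell.
have sumf i := sumg (f i) M (@cf i) (bf i).
have est i a : `|fine (Q (cell a)) * f i (y a) - \int[Q]_(x in cell a) (f i : borel T -> R) x|
    <= fine (Q (cell a)) * eps.
  have mc := measurable_cell a.
  have [h|h] := pselect (cell a `&` msupport Q !=set0).
    have hya := (hy a).2 h.
    have hx x : cell a x -> f i (y a) - eps <= f i x <= f i (y a) + eps.
      by move=> ax; rewrite -ler_distl; exact: (@cell_osc a i x _ ax hya).
    have /andP[h1 h2] := Rintegral_bounds Q (@cf i) (bf i) mc hx.
    by rewrite ler_norml; apply/andP; split; lra.
  (* A cell that misses the support is null, so its representative may lie elsewhere. *)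
  have Q0 : Q (cell a) = 0%E.
    apply: (subset_measure0 _ _ _ suppQ) => //.
      by apply: open_borel_measurable; exact: open_msupportC.
    by move=> x ax sx; apply: h; exists x.
  have hx x : cell a x -> - M <= f i x <= M by move=> _; rewrite -ler_norml.
  have /andP := Rintegral_bounds Q (@cf i) (bf i) mc hx.
  rewrite Q0/= !mulr0 !mul0r => -[h1 h2].
  by rewrite sub0r normrN ler_norml oppr0 h1 h2.
pose s := index_enum I; pose a0 := lab x0.
have E F : \sum_(l < size s) F (nth a0 s l) = \sum_a F a :> R.
  by rewrite [RHS](big_nth a0) big_mkord.
(* The cells are listed in a sequence and the weights padded by 0, to match the indexing of the
   sticks. *)
exists (size s), (fun l => if (l < size s)%N then fine (Q (cell (nth a0 s l))) else 0).
exists (fun l => y (nth a0 s l)); split.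
- by move=> l; case: ifP => // _; exact: fine_ge0.
- by move=> l h; rewrite ltnNge h.
- by rewrite -sumQ -E; apply: eq_bigr => l _; rewrite ltn_ord.
- by move=> l; case: (hy (nth a0 s l)).
- move=> i; rewrite sumf -E -sumrB.
  rewrite -[leRHS]mul1r -sumQ mulr_suml -[leRHS]E.
  apply: le_trans (ler_norm_sum _ _ _) _; apply: ler_sum => l _.
  by rewrite ltn_ord; exact: est.
Qed.

End Grid.

End BorelMeasures.

(** * Full support *)

Section FullSupport.
Context {R : realType} {T : completePseudoMetricType R} {d : measure_display}
  {Omega : measurableType d}.
Variables (N : nat) (al be : nat -> R) (P0 : probability (borel T) R)
  (Pr : probability Omega R) (v : nat -> Omega -> R) (th : nat -> Omega -> borel T).
Hypotheses (sepT : separable_space T) (hal : forall j, 0 < al j) (hbe : forall j, 0 < be j)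
  (hP : is_BMSBp N al be P0 Pr v th).

(** Atoms and sticks are independent, so the probability is a product of positive factors;
    intersecting with the almost sure event [in01] does not change it. *)
Lemma BMSBp_rect_gt0 m (s t : nat -> R) (U : nat -> set T) :
  (forall i, 0 <= s i) -> (forall i, s i < t i) -> (forall i, t i <= 1) ->
  (forall i, open (U i)) -> (forall i, (0 < P0 (U i))%E) ->
  exists A : set Omega, [/\ measurable A, (0 < Pr A)%E &
    forall w, A w -> in01 v w /\
      forall i, (i < m)%N -> s i < v i w < t i /\ U i (th i w)].
Proof.
have [mv mth hv0 hvS hind] := hP.
move=> s0 st t1 oU PU.
have mU i : measurable (U i : set (borel T)) by exact: open_borel_measurable.
have mI i : measurable (`]s i, t i[%classic : set R) by exact: measurable_itv.
pose A0 := [set w | forall i, (i < m)%N -> `]s i, t i[%classic (v i w) /\ U i (th i w)].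
have mA0 : measurable A0.
  have -> : A0 = \bigcap_(i in `I_m) (v i @^-1` `]s i, t i[%classic `&` th i @^-1` U i).
    by apply/seteqP; split.
  apply: fin_bigcap_measurable => [|i _]; first exact: finite_II.
  apply: measurableI; first exact: (measurable_preim mv).
  by rewrite -[X in measurable X]setTI; exact: mth.
have m01 := measurable_in01 mv.
exists (A0 `&` in01 v); split.
- exact: measurableI.
- have -> : Pr (A0 `&` in01 v) = Pr A0.
    have n01 : Pr (~` in01 v) = 0%E.
      by rewrite probability_setC// (Pr_in01 hal hbe mv hv0 hvS) subee.
    rewrite -[in RHS](setIT A0) -(setUv (in01 v)) setIUr measureU//.
    + rewrite [X in (_ + X)%E](_ : _ = 0%E) ?adde0//.
      apply: (subset_measure0 _ _ _ n01) => //.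
      * by apply: measurableI => //; exact: measurableC.
      * exact: measurableC.
    + exact: measurableI.
    + by apply: measurableI => //; exact: measurableC.
    + by rewrite setIACA setICr setI0.
  have -> := hind m _ _ mI mU; apply: mule_gt0.
    exact: (rect_gt0 hal hbe mv hv0 hvS).
  by elim/big_ind : _ => // x y x0 y0; exact: mule_gt0.
- move=> w [h h01]; split => // i im; exact: h.
Qed.

Lemma BMSBp_full_support : full_support Pr P0 v th.
Proof.
move=> Q sQ k f eps eps0 cf bf.
have [Mi hMi] := choice bf.
pose M : R := 1 + \sum_i `|Mi i|.
have M0 : 0 < M by rewrite ltr_pwDl// sumr_ge0.
have hM i x : `|f i x| <= M.
  rewrite (le_trans (hMi i x))// (le_trans (ler_norm _))// /M (bigD1 i)//=.
  by rewrite addrCA lerDl addr_ge0// sumr_ge0.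
(* One quarter each for discretising [Q], for the displacement of the atoms, and for the weights
   together with the leftover mass; the total is below [eps]. *)
have e4 : 0 < eps / 4 by rewrite divr_gt0.
have [m [q [x [q0 qm q1 sx hq]]]] := finite_approx (msupportC0 sepT Q) e4 cf hM.
pose U l := [set y | forall i, `|f i y - f i (x l)| < eps / 4].
have oU l : open (U l).
  rewrite openE => y hy; rewrite /interior/=; apply: filter_forall => i.
  have c : continuous (fun y => `|f i y - f i (x l)|).
    by move=> z; apply: cvg_norm; apply: cvgB; [exact: cf|exact: cvg_cst].
  have : open ((fun y => `|f i y - f i (x l)|) @^-1` `]-oo, eps / 4[%classic).
    by move/continuousP : c; apply; exact: interval_open.
  rewrite openE => /(_ y); rewrite /= in_itv/= => /(_ (hy i)).
  by apply: filterS => z; rewrite /= in_itv.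
have PU l : (0 < P0 (U l))%E.
  by apply: (sQ _ (sx l)) => // i; rewrite subrr normr0.
(* The tolerance on each stick: weights and leftover mass contribute at most [(2 m + m^2) M D], and
   [D] makes [(M + 1) (m + 1)^2 D] equal to [eps / 4]. *)
pose D : R := eps / (4 * (M + 1) * (m.+1%:R) ^+ 2).
have D0 : 0 < D.
  by rewrite divr_gt0// !mulr_gt0 ?exprn_gt0 ?ltr0n// ltr_pwDl// ltW.
have iv l := stick_inv01 q0 qm q1 l.
(* Truncation to [0, 1] leaves a nonempty open interval even when the target stick is 0 or 1. *)
pose s l := Num.max 0 (stick_inv q l - D).
pose t l := Num.min 1 (stick_inv q l + D).
have [||||| A [mA PA hA]] := @BMSBp_rect_gt0 m s t U => //.
- by move=> i; rewrite /s le_max lexx.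
- move=> i; rewrite /s /t gt_max !lt_min; have /andP[h0 h1] := iv i.
  by rewrite ltr01/=; apply/and3P; split; lra.
- by move=> i; rewrite /t ge_min lexx.
exists A; split => // w /hA [h01 hw] i.
pose u l := v l w.
have u01 l : 0 <= u l <= 1 by have /andP[/ltW-> /ltW->] := h01 l.
have uD l : (l < m)%N -> `|u l - stick_inv q l| <= D.
  move=> lm; have [/andP[h1 h2] _] := hw l lm.
  move: h1 h2; rewrite /s /t gt_max lt_min => /andP[_ h1] /andP[_ h2].
  rewrite ler_distl; apply/andP; split; rewrite /u; lra.
have wq l : (l < m)%N -> `|stick_seq u l - q l| <= m%:R * D.
  move=> lm; rewrite -(stick_seq_inv q0 qm q1).
  apply: le_trans (stick_seq_dist u01 iv (fun j jl => uD j (leq_ltn_trans jl lm))) _.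
  by rewrite ler_wpM2r ?(ltW D0)// ler_nat.
(* The target sticks use up all the mass, so the actual remainder is only the accumulated error. *)
have rm : stick_rem_seq u m <= m%:R * D.
  have := stick_rem_seq_dist u01 iv uD.
  by rewrite (stick_rem_seq_inv q0 qm q1) q1 subrr subr0; apply: le_trans; exact: ler_norm.
have hc : `|fine (\int[P0]_x (f i x)%:E)%E| <= M.
  have hx y : setT y -> - M <= f i y <= M by move=> _; rewrite -ler_norml.
  have := Rintegral_bounds P0 (@cf i) (hM i) measurableT hx.
  have -> : fine (P0 setT) = 1 by rewrite probability_setT.
  by rewrite !mulr1 -ler_norml.
have hlim := stick_limit_dist (g := fun j => f i (th j w)) m u01 (fun j => hM i _) hc.
have hsum : `|\sum_(l < m) (stick_seq u l * f i (th l w)) - \sum_(l < m) q l * f i (x l)|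
    <= m%:R * (m%:R * D * M) + eps / 4.
  rewrite -sumrB; apply: le_trans (ler_norm_sum _ _ _) _.
  apply: (@le_trans _ _ (\sum_(l < m) (m%:R * D * M + q l * (eps / 4)))).
    apply: ler_sum => l _; have [_ Ul] := hw l (ltn_ord l).
    have -> : stick_seq u l * f i (th l w) - q l * f i (x l) =
      (stick_seq u l - q l) * f i (th l w) + q l * (f i (th l w) - f i (x l)) by ring.
    apply: le_trans (ler_normD _ _) _; rewrite !normrM; apply: lerD.
      by apply: ler_pM => //; exact: wq.
    by rewrite (ger0_norm (q0 l)) ler_wpM2l// ltW// Ul.
  by rewrite big_split/= sumr_const card_ord -[X in X + _]mulr_natl -mulr_suml q1 mul1r.
have hqi := hq i.
have err : 2 * M * stick_rem_seq u m + m%:R * (m%:R * D * M) <= eps / 4.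
  apply: (@le_trans _ _ ((M + 1) * m.+1%:R ^+ 2 * D)).
    apply: (@le_trans _ _ (2 * M * (m%:R * D) + m%:R * (m%:R * D * M))).
      by rewrite lerD2r ler_wpM2l// mulr_ge0// ltW.
    rewrite -natr1; have m0 : 0 <= m%:R :> R by [].
    rewrite (_ : _ + _ = (M * (2 * m%:R + m%:R ^+ 2)) * D); last by ring.
    rewrite ler_wpM2r ?(ltW D0)//; have := mulr_ge0 (ltW M0) m0; nra.
  rewrite /D le_eqVlt; apply/orP; left; apply/eqP; field.
  have m0 : 0 <= m%:R :> R by [].
  by apply/andP; split; apply: lt0r_neq0; lra.
set I := bmsb_integral _ _ _ _ _; set J := fine (\int[Q]_x _)%E in hqi *.
move: hlim; rewrite -/(stick_seq u) => hlim.
have hI : `|I - \sum_(l < m) (stick_seq u l * f i (th l w))| <= 2 * M * stick_rem_seq u m.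
  exact: hlim.
move: hI hsum hqi; set S1 := \sum_(l < m) (stick_seq u l * _).
set S2 := \sum_(l < m) q l * _ => hI hsum hqi.
have -> : I - J = (I - S1) + (S1 - S2) + (S2 - J) by ring.
apply: le_lt_trans (ler_normD _ _) _.
apply: (@le_lt_trans _ _ (2 * M * stick_rem_seq u m + (m%:R * (m%:R * D * M) + eps / 4) + eps / 4)).
  by apply: lerD => //; apply: le_trans (ler_normD _ _) _; exact: lerD.
lra.
Qed.

End FullSupport.

Theorem mainTheorem10 (R : realType) (T : completePseudoMetricType R)
  (hT : hausdorff_space T) (sepT : separable_space T)
  (N : nat) (al be : nat -> R)
  (hal : forall j, 0 < al j) (hbe : forall j, 0 < be j)
  (P0 : probability (borel T) R) (hP0 : diffuse P0)
  (d : measure_display) (Omega : measurableType d) (Pr : probability Omega R)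
  (v : nat -> Omega -> R) (th : nat -> Omega -> borel T)
  (hP : is_BMSBp N al be P0 Pr v th) :
  [/\ ((fun n => \sum_(j < n) (al j / (al j + be j))) @ \oo --> +oo ->
       (limn_esup (fun j => ((al j + be j)^-1)%:E) < +oo)%E ->
       bmsb_proper Pr v),
      (forall j, {ae Pr, forall w, 0 < stick_w v j w}) &
      full_support Pr P0 v th].
Proof.
have [mv _ hv0 hvS _] := hP.
split; last exact: BMSBp_full_support hP.
- move=> hs hlim.
  have hdiv := @drift_diverges _ N _ _ hal hbe hs hlim.
  apply: filterS (ae_stick_rem_cvg0 hal hbe mv hv0 hvS hdiv) => w h.
  rewrite (_ : (fun n => _) = (fun n => 1 - stick_rem v n w)); last first.
    by apply/funext => n; exact: sum_stick_w.
  by rewrite -[X in _ --> X]subr0; apply: cvgB => //; exact: cvg_cst.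
- move=> j; apply: filterS (ae_in01 hal hbe mv hv0 hvS) => w; exact: stick_w_gt0.
Qed.
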